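(* Let $X,Y$ be analytic curves in a neighbourhood $U$ of $\mathbf 0\in\mathbb{C}^n$ such that $\mathbf 0\in X\cap Y$ and the germs $(X)_{\mathbf 0}$, $(Y)_{\mathbf 0}$ are irreducible. Let $$\Phi(t)=(t^{k},\phi_2(t),\dots,\phi_n(t)),\quad t\in K(r),\quad \operatorname{ord}\phi_i>k,\ i=2,\dots,n,$$ $$\Psi(\tau)=(\tau^{l},\psi_2(\tau),\dots,\psi_n(\tau)),\quad \tau\in K(r),\quad \operatorname{ord}\psi_i>l,\ i=2,\dots,n,$$ be parametrizations of $X$ and $Y$ at $\mathbf 0$, respectively. Assume that $l\le k$. Let $\varepsilon_1,\dots,\varepsilon_l$ be all the complex roots of unity of degree $l$ (i.e. all solutions of $\varepsilon^l=1$). For $i=1,\dots,l$ define $$n_i:=\begin{cases}\operatorname{ord}\bigl(\Phi(t^{l})-\Psi(\varepsilon_i t^{k})\bigr) & \text{if } \Phi(t^{l})-\Psi(\varepsilon_i t^{k})\not\equiv 0,\\ 0 & \text{if } \Phi(t^{l})-\Psi(\varepsilon_i t^{k})\equiv 0,\end{cases}\qquad \mathbf v_i:=\lim_{t\to 0}\frac{\Phi(t^{l})-\Psi(\varepsilon_i t^{k})}{t^{n_i}} .$$ Then $$C_{0}(X,Y)=\operatorname{Lin}(\mathbf v_1,\mathbf e_1)\cup\dots\cup\operatorname{Lin}(\mathbf v_l,\mathbf e_1).$$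
   Context: $K(r):=\{z\in\mathbb{C}:|z|<r\}$, $r>0$. An analytic curve is an analytic set of pure dimension $1$ in an open subset $U$ of $\mathbb{C}^n$. A parametrization of an analytic curve $\Gamma\subset U$ at $P\in\Gamma$ is a holomorphic map $\Phi:K(r)\to U$ with $\Phi(0)=P$ which is a homeomorphism onto its image, where $\Phi(K(r))=\Gamma\cap U'$ for some open neighbourhood $U'\subset U$ of $P$. For a holomorphic function of one variable, $\operatorname{ord}$ is its order of vanishing at $0$ ($+\infty$ for the zero function); for a map $F=(f_1,\dots,f_n)$, $\operatorname{ord}F:=\min_i\operatorname{ord}f_i$. For analytic subsets $X,Y$ of a neighbourhood of $\mathbf 0\in\mathbb{C}^n$ with $\mathbf 0\in X\cap Y$, the relative tangent cone $C_0(X,Y)$ is the set of all $\mathbf v\in\mathbb{C}^n$ for which there exist sequences $(\mathbf x_\nu)$ in $X$, $(\mathbf y_\nu)$ in $Y$ and $(\lambda_\nu)$ in $\mathbb{C}$ with $\mathbf x_\nu\to\mathbf 0$, $\mathbf y_\nu\to\mathbf 0$, $\lambda_\nu(\mathbf y_\nu-\mathbf x_\nu)\to\mathbf v$ as $\nu\to\infty$. $\mathbf e_1=(1,0,\dots,0)$, and $\operatorname{Lin}(\mathbf v,\mathbf w)$ denotes the complex linear subspace of $\mathbb{C}^n$ spanned by $\mathbf v$ and $\mathbf w$ (so $\operatorname{Lin}(\mathbf 0,\mathbf e_1)=\mathbb{C}\mathbf e_1$). *)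

(* Defs.v *)
From HB Require Import structures.
From mathcomp Require Import all_boot all_order all_algebra.
From mathcomp Require Import all_classical all_reals all_analysis.
From mathcomp Require Import complex.
Set Implicit Arguments.
Unset Strict Implicit.
Unset Printing Implicit Defensive.
Import Order.TTheory GRing.Theory Num.Theory numFieldNormedType.Exports.
Local Open Scope classical_set_scope.
Local Open Scope ring_scope.

(* The field of complex numbers. Packing [R[i]] as a [numClosedFieldType] gives
   it (and ['rV[CC R]_n]) the norm topology of [numFieldNormedType], hence
   differentiability over the complex numbers. The definitions below are stated
   over an abstract [K]; they have their intended meaning for [K := CC R]. *)
Definition CC (R : realType) : numClosedFieldType := R[i]%C.

Definition of_real (R : realType) (x : R) : CC R := (x%:C)%C.

Section Holomorphy.
Context {K : numClosedFieldType}.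

Definition disc (r : K) : set K := [set z | `|z| < r].

(* Only used on open domains [D]: complex (Frechet) differentiability. *)
Definition holomorphic_on (V W : normedModType K) (D : set V) (f : V -> W) :=
  forall x, D x -> differentiable f x.

Definition biholomorphic n (V W : set 'rV[K]_n) (h g : 'rV[K]_n -> 'rV[K]_n) :=
  [/\ open V /\ open W,
      holomorphic_on V h /\ holomorphic_on W g,
      h @` V `<=` W /\ g @` W `<=` V,
      forall x, V x -> g (h x) = x &
      forall y, W y -> h (g y) = y].

(* [M] is near each of its points straightened to the d-plane
   [w_d = ... = w_(n-1) = 0] by a biholomorphic change of coordinates. *)
Definition submanifold n (d : nat) (M : set 'rV[K]_n) :=
  (d <= n)%N /\
  forall a, M a -> exists V W h g,
    [/\ V a, biholomorphic V W h g &
        h @` (M `&` V) =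
        W `&` [set w | forall i : 'I_n, (d <= i)%N -> w 0 i = 0]].

(* The dimension of a set is the largest dimension of a nonempty submanifold
   contained in it; the dimension at [a] is that of the intersection with all
   small enough neighbourhoods of [a]. *)
Definition local_dim n (A : set 'rV[K]_n) (a : 'rV[K]_n) (d : nat) :=
  (forall V, open V -> V a ->
     exists M, [/\ M !=set0, M `<=` A `&` V & submanifold d M]) /\
  (exists V, [/\ open V, V a &
     forall e M, M !=set0 -> M `<=` A `&` V -> submanifold e M -> (e <= d)%N]).

Definition analytic_subset n (U A : set 'rV[K]_n) :=
  A `<=` U /\
  forall a, U a -> exists V (p : nat) (f : 'I_p -> 'rV[K]_n -> K),
    [/\ open V, V a, V `<=` U,
        forall i, holomorphic_on V (f i) &
        A `&` V = [set z | V z /\ forall i, f i z = 0]].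

Definition analytic_curve n (U A : set 'rV[K]_n) :=
  [/\ open U, analytic_subset U A & forall a, A a -> local_dim A a 1].

Definition germ_eq n (a : 'rV[K]_n) (A B : set 'rV[K]_n) :=
  \forall z \near a, A z <-> B z.

(* The germ of [A] at [a] is nonempty and is not the union of two analytic
   germs both different from it. *)
Definition irreducible_germ n (a : 'rV[K]_n) (A : set 'rV[K]_n) :=
  A a /\
  forall W A1 A2, open W -> W a ->
    analytic_subset W A1 -> analytic_subset W A2 ->
    germ_eq a A (A1 `|` A2) -> germ_eq a A A1 \/ germ_eq a A A2.

Definition homeomorphism_onto_image (T T' : topologicalType)
    (D : set T) (f : T -> T') :=
  {within D, continuous f} /\
  exists g : T' -> T,
    (forall t, D t -> g (f t) = t) /\ {within f @` D, continuous g}.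

Definition parametrization n (U G : set 'rV[K]_n) (P : 'rV[K]_n)
    (r : K) (Phi : K -> 'rV[K]_n) :=
  [/\ holomorphic_on (disc r) Phi,
      Phi @` disc r `<=` U,
      Phi 0 = P,
      homeomorphism_onto_image (disc r) Phi &
      exists U', [/\ open U', U' `<=` U, U' P & Phi @` disc r = G `&` U']].

Definition relative_tangent_cone n (X Y : set 'rV[K]_n) : set 'rV[K]_n :=
  [set v | exists (x y : nat -> 'rV[K]_n) (lambda : nat -> K),
     [/\ (forall j, X (x j)) /\ (forall j, Y (y j)),
         x j @[j --> \oo] --> (0 : 'rV[K]_n),
         y j @[j --> \oo] --> (0 : 'rV[K]_n) &
         lambda j *: (y j - x j) @[j --> \oo] --> v]].

Definition Lin n (v w : 'rV[K]_n) : set 'rV[K]_n :=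
  [set u | u \in <<[:: v; w]>>%VS].

End Holomorphy.

Section Order.
Context (R : realType) {K : numClosedFieldType}.

(* Order of vanishing at 0 of a function holomorphic near 0, in
   {0, 1, 2, ..., +oo}: the infimum is +oo when all derivatives vanish. *)
Definition ord (f : K -> K) : \bar R :=
  ereal_inf [set m%:R%:E | m in [set m : nat | derive1n m f 0 != 0]].

Definition ord_map n (F : K -> 'rV[K]_n) : \bar R :=
  \big[Order.min/+oo%E]_(i < n) ord (fun t => F t 0 i).

Section Contact.
Context {n : nat} (k l : nat) (r : K) (Phi Psi : K -> 'rV[K]_n) (e : K).

Definition gap (t : K) : 'rV[K]_n := Phi (t ^+ l) - Psi (e * t ^+ k).

(* Vanishing on the whole domain of [gap], as [Phi] and [Psi] are only
   meaningful on [disc r]. *)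
Definition gap_eq0 :=
  forall t, disc r (t ^+ l) -> disc r (e * t ^+ k) -> gap t = 0.

Definition contact_order : nat :=
  if `[< gap_eq0 >] then 0%N else Num.truncn (fine (ord_map gap)).

Definition contact_direction : 'rV[K]_n :=
  lim (t ^- contact_order *: gap t @[t --> 0^']).

End Contact.
End Order.

(* Main.v *)
Require Import Defs.
From HB Require Import structures.
From mathcomp Require Import all_boot all_order all_algebra.
From mathcomp Require Import all_classical all_reals all_analysis.
From mathcomp Require complex.
From mathcomp Require Import separable cyclotomic.
From mathcomp Require Import ring lra.
Import Order.TTheory GRing.Theory Num.Theory numFieldNormedType.Exports.
Set Implicit Arguments.
Unset Strict Implicit.
Unset Printing Implicit Defensive.
Local Open Scope classical_set_scope.
Local Open Scope ring_scope.

(** Both curves are parametrized by holomorphic maps of one variable, and a point of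
    the first one near the origin is [Phi (t ^+ l)] for some small [t]. The second
    branch has [l] points over the same first coordinate [t ^+ (k * l)], namely the
    [Psi (e * t ^+ k)] where [e] runs through the [l]-th roots of unity, and
    [gap t = Phi (t ^+ l) - Psi (e * t ^+ k)] is the vector between the two points.
    Since holomorphic functions can be divided by the variable as long as they
    vanish at 0, either the gap is zero, or [gap t = t ^+ N *: G t] with [G]
    continuous at 0, [G 0 != 0] and [N > k * l]; then [G 0] is the contact direction
    ([contact_direction_spec]).

    A vector [Psi tau - Phi (t ^+ l)] is [B - gap t] with
    [B = Psi tau - Psi (e * t ^+ k)]. The coordinates of [Psi] other than the first
    vanish to order greater than [l], which gives, near 0, the estimate
    [`|psi a - psi b| <= M * (`|a| + `|b|) ^+ l * `|a - b|] ([branch_lipschitz]). If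
    [e * t ^+ k] is, among the points with the same [l]-th power, nearest to [tau],
    then the first coordinate [tau ^+ l - t ^+ (k * l)] of [B] has modulus at least
    a constant times [(`|a| + `|b|) ^+ l.-1 * `|a - b|] with [a = tau] and
    [b = e * t ^+ k] ([nearest_root_lower_bound]), so [B] is asymptotically parallel
    to the first basis vector. The first coordinate of the gap is zero. So if
    [la *: (Psi tau - Phi (t ^+ l))] converges, then the first coordinate converges,
    hence [la *: B] converges to a multiple of the first basis vector, and
    [la *: gap t] converges as well, to a multiple of [G 0]. Such an [e] can be kept
    fixed along infinitely many indices of the sequences, so the cone is contained
    in the union of the spans ([limit_in_Lin], [cone_in_Lin]). Conversely,
    a vector [a *: G 0 + b *: delta_mx 0 0] with [a != 0] is a limit of secants for
    which the parameter of [Psi] is slightly displaced from [e * t ^+ k], so that [B]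
    contributes the second term ([contact_direction_in_cone]); the multiples of the
    first basis vector are limits of secants through the origin
    ([first_vector_in_cone]).

    The analytic input is that complex differentiability on a disc implies Cauchy's
    formula. A function continuous on the plane has primitives along horizontal and
    along vertical lines, by the fundamental theorem of calculus for its real and
    imaginary parts. Goursat's subdivision argument shows that they match on the
    boundary of a rectangle ([goursat_rectangle]), so holomorphic functions on
    a disc have primitives ([holomorphic_primitive]). If [F] is a primitive of [f],
    then the difference quotients of [F] are holomorphic, including at the base
    point, because [F] has a second order expansion there; so they have primitives,
    their integral over circles is zero, and this is Cauchy's formula for [F].
    Differentiating under the integral, [F] has derivatives of all orders, and so
    has [f] ([holomorphic_derive1]). Division by the variable and the identity
    theorem follow ([flat_factor], [identity_theorem]). *)

(** * The complex field over the reals *)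

Section OfReal.
Variable R : realType.

Let of_real_additive (x y : R) : of_real (x - y) = of_real x - of_real y.
Proof.
by apply/eqP; rewrite complex.eq_complex /= subrr !eqxx.
Qed.

Let of_real_multiplicative : GRing.monoid_morphism (@of_real R).
Proof.
split=> // x y; apply/eqP; rewrite complex.eq_complex /=.
by rewrite !(mulr0, mul0r) subr0 addr0 !eqxx.
Qed.

HB.instance Definition _ :=
  GRing.isZmodMorphism.Build R (CC R) (@of_real R) of_real_additive.
HB.instance Definition _ :=
  GRing.isMonoidMorphism.Build R (CC R) (@of_real R) of_real_multiplicative.
End OfReal.

Section ComplexNumbers.
Context {R : realType}.
Notation C := (CC R).
Implicit Types (x y : R) (z w : C).

Definition re z : R := complex.Re z.
Definition im z : R := complex.Im z.
Definition ci : C := complex.Complex 0 1.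

Arguments re : simpl never.
Arguments im : simpl never.

Lemma of_realD x y : of_real (x + y) = of_real x + of_real y.
Proof. exact: rmorphD. Qed.
Lemma of_realB x y : of_real (x - y) = of_real x - of_real y.
Proof. exact: rmorphB. Qed.
Lemma of_realM x y : of_real (x * y) = of_real x * of_real y.
Proof. exact: rmorphM. Qed.

Lemma complex_eq z w : re z = re w -> im z = im w -> z = w.
Proof. by case: z w => [a b] [c d]; rewrite /re /im /= => -> ->. Qed.

Lemma le_of_real x y : (of_real x <= of_real y) = (x <= y).
Proof. by rewrite [LHS]complex.lecE /= eqxx. Qed.
Lemma lt_of_real x y : (of_real x < of_real y) = (x < y).
Proof. by rewrite [LHS]complex.ltcE /= eqxx. Qed.
Lemma of_real_gt0 x : (0 < of_real x) = (0 < x).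
Proof. exact: (lt_of_real 0). Qed.
Lemma of_real_ge0 x : (0 <= of_real x) = (0 <= x).
Proof. exact: (le_of_real 0). Qed.
Lemma of_real_eq0 x : (of_real x == 0) = (x == 0).
Proof. exact: fmorph_eq0. Qed.
Lemma norm_of_real x : `|of_real x| = of_real `|x|.
Proof.
have [x0|x0] := lerP 0 x; first by rewrite !ger0_norm ?of_real_ge0.
by rewrite !ltr0_norm ?rmorphN// -oppr_gt0 -rmorphN of_real_gt0 oppr_gt0.
Qed.
Lemma ge0_of_real z : 0 <= z -> z = of_real (re z).
Proof. by case: z => a b; rewrite [_ <= _]complex.lecE /= => /andP[/eqP-> _]. Qed.
Lemma re_of_real x : re (of_real x) = x. Proof. by []. Qed.
Lemma im_of_real x : im (of_real x) = 0. Proof. by []. Qed.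

Lemma reD z w : re (z + w) = re z + re w. Proof. by case: z w => [? ?] []. Qed.
Lemma imD z w : im (z + w) = im z + im w. Proof. by case: z w => [? ?] []. Qed.
Lemma reN z : re (- z) = - re z. Proof. by case: z. Qed.
Lemma imN z : im (- z) = - im z. Proof. by case: z. Qed.
Lemma reM z w : re (z * w) = re z * re w - im z * im w.
Proof. by case: z w => [? ?] []. Qed.
Lemma imM z w : im (z * w) = re z * im w + im z * re w.
Proof. by case: z w => [? ?] []. Qed.
Lemma re_ci : re ci = 0. Proof. by []. Qed.
Lemma im_ci : im ci = 1. Proof. by []. Qed.
Definition reimE := (reD, imD, reN, imN, reM, imM, re_ci, im_ci, re_of_real, im_of_real).

Lemma complexE z : z = of_real (re z) + ci * of_real (im z).
Proof. apply: complex_eq; rewrite !reimE; ring. Qed.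

Lemma normE z : `|z| = of_real (Num.sqrt (re z ^+ 2 + im z ^+ 2)).
Proof. exact: complex.normc_def. Qed.

Lemma norm_re z : of_real `|re z| <= `|z|.
Proof. by rewrite normE le_of_real -sqrtr_sqr ler_wsqrtr// lerDl sqr_ge0. Qed.
Lemma norm_im z : of_real `|im z| <= `|z|.
Proof. by rewrite normE le_of_real -sqrtr_sqr ler_wsqrtr// lerDr sqr_ge0. Qed.
Lemma norm_ci : `|ci| = 1.
Proof. by rewrite normE /= expr0n /= add0r expr1n sqrtr1. Qed.

Lemma norm_le_reim z : `|z| <= of_real (`|re z| + `|im z|).
Proof.
rewrite {1}[z]complexE (le_trans (ler_normD _ _))// normrM norm_ci mul1r.
by rewrite !norm_of_real -rmorphD.
Qed.

Lemma of_real_norm z : of_real (re `|z|) = `|z|.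
Proof. by rewrite -ge0_of_real. Qed.

Lemma near_dist_le (K : numFieldType) (V : normedModType K) (z : V) (e : K) :
  0 < e -> \forall w \near z, `|z - w| <= e.
Proof.
move=> e0; have /cvgrPdist_le/(_ e e0) : id @ z --> z by exact: cvg_id.
exact.
Qed.

Lemma near_disc (a : C) v : disc a v -> \forall u \near v, disc a u.
Proof.
move=> va; have e0 : 0 < (a - `|v|) / 2 by rewrite divr_gt0// subr_gt0.
apply: filterS (near_dist_le v e0) => u uv.
rewrite /disc /= -(subrK v u) (le_lt_trans (ler_normD _ _))// distrC.
rewrite -ltrBrDr (le_lt_trans uv)// ltr_pdivrMr// ltr_pMr ?subr_gt0//.
by rewrite ltr1n.
Qed.

Lemma continuous_re : continuous re.
Proof.
move=> z; apply/(@cvgrPdist_le _ _ _ (nbhs z)) => e e0.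
apply: filterS (near_dist_le z (_ : 0 < of_real e)); last by rewrite of_real_gt0.
by move=> w; rewrite -le_of_real -reN -reD; apply: le_trans (norm_re _).
Qed.

Lemma continuous_im : continuous im.
Proof.
move=> z; apply/(@cvgrPdist_le _ _ _ (nbhs z)) => e e0.
apply: filterS (near_dist_le z (_ : 0 < of_real e)); last by rewrite of_real_gt0.
by move=> w; rewrite -le_of_real -imN -imD; apply: le_trans (norm_im _).
Qed.

Lemma continuous_of_real : continuous (@of_real R).
Proof.
move=> x; apply/cvgrPdist_le => e e0; have eE := ge0_of_real (ltW e0).
apply: filterS (near_dist_le x (_ : 0 < re e)); last by rewrite -of_real_gt0 -eE.
by move=> y; rewrite -rmorphB norm_of_real [in X in _ -> X]eE le_of_real.
Qed.
End ComplexNumbers.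

Opaque CC of_real re im ci.

(** * Derivatives and primitives of curves in the complex plane *)

Section DifferenceQuotient.
Variable K : numFieldType.

Lemma is_derive_near (f : K -> K) (z d : K) : is_derive z 1 f d <->
  forall e, 0 < e -> \forall w \near z, `|f w - f z - d * (w - z)| <= e * `|w - z|.
Proof.
split=> [[fz dE] e e0|H].
- have : h^-1 *: (f (h *: 1 + z) - f z) @[h --> 0^'] --> d.
    by rewrite -dE; exact: fz.
  move=> /cvgrPdist_le /(_ e e0).
  rewrite near_withinE /= => /nbhs_normP [r /= r0 H].
  apply/nbhs_normP; exists r => //= w wz.
  have [->|nwz] := eqVneq w z; first by rewrite !subrr mulr0 subrr normr0 mulr0.
  have wz0 : w - z != 0 by rewrite subr_eq0.
  move: (H (w - z)); rewrite /= sub0r normrN distrC => /(_ wz wz0).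
  rewrite scaler1 subrK -[_ *: _]/(_ * _) => Hw.
  rewrite (_ : _ - _ = ((w - z)^-1 * (f w - f z) - d) * (w - z)); last first.
    by rewrite mulrBl mulrAC mulVf// mul1r.
  by rewrite normrM [`|w - z|]distrC ler_wpM2r// distrC.
- have cv : h^-1 *: (f (h *: 1 + z) - f z) @[h --> 0^'] --> d.
    apply/cvgrPdist_le => e e0; rewrite near_withinE.
    have /nbhs_normP[r /= r0 Hr] := H e e0.
    apply/nbhs_normP; exists r => //= h /=; rewrite sub0r normrN => hr h0.
    rewrite scaler1 -[_ *: _]/(_ * _).
    have := Hr (h + z); rewrite /= opprD addrCA subrr addr0 normrN => /(_ hr).
    rewrite addrK => Hh; have h1 : 0 < `|h| by rewrite normr_gt0.
    rewrite -(ler_pM2r h1) -normrM (le_trans _ Hh)// -normrN -mulNr opprB.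
    by rewrite mulrBl mulrAC mulVf// mul1r.
  split; first by apply/cvg_ex; exists d.
  exact: cvg_lim.
Qed.

End DifferenceQuotient.

Section Curves.
Context {R : realType}.
Notation C := (CC R).
Implicit Types (G : R -> C) (F : C -> C).

(** The parameter is real but the plane is taken as a normed space over itself, not
    over the reals, so this is not an instance of [is_derive]; the estimate is the
    one of [is_derive_near]. *)
Definition curve_derive G (t : R) (g : C) := forall e : R, 0 < e ->
  \forall s \near t, `|G s - G t - g * of_real (s - t)| <= of_real (e * `|s - t|).

Lemma curve_derive_cst (c : C) t : curve_derive (fun=> c) t 0.
Proof.
move=> e e0; near=> s; rewrite subrr mul0r subr0 normr0 of_real_ge0.
by rewrite mulr_ge0// ltW.
Unshelve. all: by end_near. Qed.

Lemma curve_deriveD G1 G2 t g1 g2 : curve_derive G1 t g1 -> curve_derive G2 t g2 ->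
  curve_derive (fun s => G1 s + G2 s) t (g1 + g2).
Proof.
move=> H1 H2 e e0; have e2 : 0 < e / 2 by rewrite divr_gt0.
apply: filterS2 (H1 _ e2) (H2 _ e2) => s.
set a := G1 s - _ - _; set b := G2 s - _ - _ => Ha Hb.
rewrite (_ : _ - _ = a + b); last by rewrite /a /b; ring.
rewrite (le_trans (ler_normD _ _))// (le_trans (lerD Ha Hb))// -of_realD.
by rewrite le_of_real -mulrDl -splitr.
Qed.

Lemma curve_deriveZ G t g c : curve_derive G t g ->
  curve_derive (fun s => c * G s) t (c * g).
Proof.
move=> H e e0; have [->|c0] := eqVneq c 0.
  near=> s; rewrite !mul0r !subrr normr0 of_real_ge0.
  by rewrite mulr_ge0// ltW.
have c1 : 0 < re `|c| by rewrite -of_real_gt0 of_real_norm normr_gt0.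
apply: filterS (H _ (divr_gt0 e0 c1)) => s Hs.
rewrite -mulrA -!mulrBr normrM -of_real_norm.
apply: le_trans (ler_wpM2l _ Hs) _; first by rewrite of_real_ge0 ltW.
rewrite -of_realM le_of_real le_eqVlt; apply/orP; left; apply/eqP; field.
by rewrite gt_eqF.
Unshelve. all: by end_near. Qed.

Lemma curve_deriveB G1 G2 t g1 g2 : curve_derive G1 t g1 -> curve_derive G2 t g2 ->
  curve_derive (fun s => G1 s - G2 s) t (g1 - g2).
Proof.
move=> H1 H2; have := curve_deriveD H1 (curve_deriveZ (-1) H2).
by rewrite mulN1r; under eq_fun do rewrite mulN1r.
Qed.

Lemma curve_derive_of_real t : curve_derive (@of_real R) t 1.
Proof.
move=> e e0; near=> s; rewrite mul1r of_realB subrr normr0 of_real_ge0.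
by rewrite mulr_ge0// ltW.
Unshelve. all: by end_near. Qed.

Lemma curve_derive_near G t g : curve_derive G t g ->
  exists2 M : R, 0 < M &
  \forall s \near t, `|G s - G t| <= of_real (M * `|s - t|).
Proof.
move=> H; exists (1 + re `|g|).
  by rewrite ltr_wpDr// -of_real_ge0 of_real_norm.
apply: filterS (H 1 ltr01) => s Hs.
rewrite -(subrK (g * of_real (s - t)) (G s - G t)).
rewrite (le_trans (ler_normD _ _))// mulrDl [of_real (_ * _ + _)]of_realD lerD//.
by rewrite normrM norm_of_real of_realM of_real_norm.
Qed.

Lemma curve_derive_continuous G t g : curve_derive G t g -> {for t, continuous G}.
Proof.
move=> /curve_derive_near[M M0 H]; apply/(@cvgrPdist_le _ _ _ (nbhs t)) => e e0.
have eE := ge0_of_real (ltW e0).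
have e1 : 0 < re e / M by rewrite divr_gt0// -of_real_gt0 -eE.
apply: filterS2 H (near_dist_le t e1) => s Hs.
rewrite ler_pdivlMr// distrC => H2.
by rewrite distrC (le_trans Hs)// [leRHS]eE le_of_real mulrC.
Qed.

Lemma curve_derive_comp F G t (d g : C) :
  is_derive (G t) 1 F d -> curve_derive G t g ->
  curve_derive (fun s => F (G s)) t (d * g).
Proof.
move=> /is_derive_near HF HG e e0.
have [M M0 HM] := curve_derive_near HG.
have e1 : 0 < e / 2 / M by rewrite !divr_gt0.
have := HF _ (_ : 0 < of_real (e / 2 / M)); rewrite of_real_gt0 => /(_ e1) HF1.
have cG := curve_derive_continuous HG.
have := cG _ HF1; rewrite nbhs_filterE /= => HF2.
have d0 : 0 < re `|d| + 1 by rewrite ltr_wpDl// -of_real_ge0 of_real_norm.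
have e2 : 0 < e / 2 / (re `|d| + 1) by rewrite !divr_gt0.
apply: filterS3 HF2 HM (HG _ e2) => s /= H1 H2 H3.
rewrite (_ : _ - _ = (F (G s) - F (G t) - d * (G s - G t)) +
  d * (G s - G t - g * of_real (s - t))); last by ring.
apply: le_trans (ler_normD _ _) _; rewrite [e]splitr mulrDl [of_real (_ * _ + _)]of_realD lerD//.
  apply: le_trans H1 _; apply: le_trans (ler_wpM2l _ H2) _.
    by rewrite of_real_ge0 ltW.
  by rewrite -of_realM le_of_real mulrA divfK ?gt_eqF.
rewrite normrM -of_real_norm.
apply: le_trans (ler_wpM2l _ H3) _; first by rewrite of_real_norm.
rewrite -of_realM le_of_real mulrA ler_wpM2r//.
rewrite mulrCA ler_piMr ?divr_ge0 ?ltW//.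
by rewrite ltr_pdivrMr// mul1r ltrDl.
Qed.

Lemma curve_derive_reim G t g : curve_derive G t g <->
  is_derive t 1 (re \o G) (re g) /\ is_derive t 1 (im \o G) (im g).
Proof.
split=> [H|[/is_derive_near Hr /is_derive_near Hi] e e0].
- split; apply/is_derive_near => e e0; apply: filterS (H e e0) => s Hs.
  + rewrite -le_of_real; apply: le_trans Hs.
    by rewrite (le_trans _ (norm_re _))// !reimE /= mulr0 subr0.
  + rewrite -le_of_real; apply: le_trans Hs.
    by rewrite (le_trans _ (norm_im _))// !reimE /= mulr0 add0r.
- have e2 : 0 < e / 2 by rewrite divr_gt0.
  apply: filterS2 (Hr _ e2) (Hi _ e2) => s /= H1 H2.
  rewrite (le_trans (norm_le_reim _))// le_of_real !reimE !mulr0 subr0 add0r.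
  by rewrite [e]splitr mulrDl lerD.
Qed.

(** Applying the real mean value theorem to the real and the imaginary part
    costs a factor 2, which is harmless everywhere below. *)
Lemma curve_mean_value G (g : R -> C) (a b M : R) : a <= b ->
  (forall t, a <= t <= b -> curve_derive G t (g t)) ->
  (forall t, a <= t <= b -> `|g t| <= of_real M) ->
  `|G b - G a| <= of_real (2 * M * (b - a)).
Proof.
move=> ab HG HM.
have in_ab t : t \in `[a, b] -> a <= t <= b by rewrite in_itv.
have in_oo t : t \in `]a, b[ -> a <= t <= b.
  by move=> tab; apply/in_ab; apply: subset_itv_oo_cc.
have part (p : C -> R) (cp : forall t, a <= t <= b -> is_derive t 1 (p \o G) (p (g t)))
    (np : forall z, of_real `|p z| <= `|z|) : `|p (G b) - p (G a)| <= M * (b - a).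
  have [||c cab ->] := @MVT_segment R (p \o G) (p \o g) a b ab.
  - by move=> t /in_oo /cp.
  - by apply: derivable_within_continuous => t /in_ab /cp[].
  - rewrite normrM (ger0_norm (_ : 0 <= b - a)) ?subr_ge0// ler_wpM2r ?subr_ge0//.
    by rewrite -le_of_real (le_trans (np _))// HM// in_ab.
rewrite (le_trans (norm_le_reim _))// le_of_real !reimE -mulrA mulr2n mulrDl mul1r.
apply: lerD; apply: part => [t /HG /curve_derive_reim[]//|z].
  exact: norm_re.
exact: norm_im.
Qed.

Lemma curve_primitive (g : R -> C) (A : R) : continuous g ->
  exists G, forall t, `|t| < A -> curve_derive G t (g t).
Proof.
move=> cg.
have prim (p : C -> R) : continuous p ->
    exists P : R -> R, forall t : R, `|t| < A -> is_derive t 1 P (p (g t)).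
  move=> cp; have cpg : continuous (p \o g).
    by move=> t; apply: continuous_comp; [exact: cg|exact: cp].
  exists (fun x => \int[lebesgue_measure]_(t in `[- A, x]) ((p \o g) t))%R => t.
  rewrite ltr_norml => /andP[At tA].
  have [|d1 d2] := @continuous_FTC1_closed R (p \o g) (- A) t A tA _ At (cpg t).
    apply: continuous_compact_integrable; first exact: segment_compact.
    exact: continuous_subspaceT.
  by split; [exact: d1|rewrite -derive1E].
have [P HP] := prim _ continuous_re; have [Q HQ] := prim _ continuous_im.
exists (fun t => of_real (P t) + ci * of_real (Q t)) => t tA.
apply/curve_derive_reim; split.
- rewrite (_ : _ \o _ = P); first exact: HP.
  by apply/funext => s; rewrite /= !reimE; ring.
- rewrite (_ : _ \o _ = Q); first exact: HQ.
  by apply/funext => s; rewrite /= !reimE; ring.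
Qed.

End Curves.

(** * Goursat's theorem on rectangles *)

Section Goursat.
Context {R : realType}.
Notation C := (CC R).
Implicit Types (x y u v : R) (z w : C).

Definition of_reim x y : C := of_real x + ci * of_real y.

Lemma re_of_reim x y : re (of_reim x y) = x.
Proof. by rewrite /of_reim !reimE !mul0r mul1r subr0 addr0. Qed.
Lemma im_of_reim x y : im (of_reim x y) = y.
Proof. by rewrite /of_reim !reimE !mul0r mul1r !add0r. Qed.
Lemma reim_of_reim z : of_reim (re z) (im z) = z.
Proof. by rewrite /of_reim -complexE. Qed.
Lemma of_reimB x y u v : of_reim x y - of_reim u v = of_reim (x - u) (y - v).
Proof. by rewrite /of_reim !of_realB; ring. Qed.
Lemma norm_of_reim x y : `|of_reim x y| <= of_real (`|x| + `|y|).
Proof. by rewrite (le_trans (norm_le_reim _))// re_of_reim im_of_reim. Qed.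

Lemma continuous_of_reiml y : continuous (of_reim ^~ y).
Proof.
move=> x; rewrite /of_reim; apply: cvgD; last exact: cvg_cst.
exact: continuous_of_real.
Qed.
Lemma continuous_of_reimr x : continuous (of_reim x).
Proof.
move=> y; rewrite /of_reim; apply: cvgD; first exact: cvg_cst.
apply: cvgMr; exact: continuous_of_real.
Qed.

Lemma curve_derive_of_reiml x y : curve_derive (of_reim ^~ y) x 1.
Proof.
rewrite -[1]addr0; apply: curve_deriveD; first exact: curve_derive_of_real.
exact: curve_derive_cst.
Qed.
Lemma curve_derive_of_reimr x y : curve_derive (of_reim x) y ci.
Proof.
rewrite -[ci]add0r; apply: curve_deriveD; first exact: curve_derive_cst.
rewrite -[X in curve_derive _ _ X]mulr1.
by apply: curve_deriveZ; exact: curve_derive_of_real.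
Qed.

Lemma curve_mean_value_abs (G : R -> C) (g : R -> C) (a b M : R) :
  (forall t, `|t - a| <= `|b - a| -> curve_derive G t (g t)) ->
  (forall t, `|t - a| <= `|b - a| -> `|g t| <= of_real M) ->
  `|G b - G a| <= of_real (2 * M * `|b - a|).
Proof.
move=> HG HM; have [ab|/ltW ba] := leP a b.
- have near_a t : a <= t <= b -> `|t - a| <= `|b - a|.
    by move=> /andP[at_ tb]; rewrite !ger0_norm ?subr_ge0// lerD2r.
  rewrite [in leRHS]ger0_norm ?subr_ge0//.
  by apply: (curve_mean_value ab) => t /near_a; [exact: HG|exact: HM].
- have near_a t : b <= t <= a -> `|t - a| <= `|b - a|.
    by move=> /andP[at_ tb]; rewrite ![`|_ - a|]distrC !ger0_norm ?subr_ge0// lerB.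
  rewrite distrC [in leRHS]distrC [in leRHS]ger0_norm ?subr_ge0//.
  by apply: (curve_mean_value ba) => t /near_a; [exact: HG|exact: HM].
Qed.

Lemma itv_dist_le (a h x y : R) :
  a <= x <= a + h -> a <= y <= a + h -> `|x - y| <= h.
Proof.
by move=> /andP[? ?] /andP[? ?]; rewrite ler_norml; apply/andP; split; lra.
Qed.

Lemma nested_intervals (a : nat -> R) (d : R) : 0 <= d ->
  (forall n, a n <= a n.+1) ->
  (forall n, a n.+1 + d / 2 ^+ n.+1 <= a n + d / 2 ^+ n) ->
  exists c, forall n, a n <= c <= a n + d / 2 ^+ n.
Proof.
move=> d0 Ha Hb.
have d2 n : 0 <= d / 2 ^+ n by rewrite divr_ge0// exprn_ge0.
have up m n : (m <= n)%N -> a m <= a n.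
  elim: n => [|n IH]; first by rewrite leqn0 => /eqP ->.
  by rewrite leq_eqVlt => /predU1P[->//|/IH /le_trans]; apply.
have down m n : (m <= n)%N -> a n + d / 2 ^+ n <= a m + d / 2 ^+ m.
  elim: n => [|n IH]; first by rewrite leqn0 => /eqP ->.
  by rewrite leq_eqVlt => /predU1P[->//|/IH]; apply: le_trans.
have cross m n : a m <= a n + d / 2 ^+ n.
  have [mn|/ltnW nm] := leqP m n; first by rewrite (le_trans (up _ _ mn))// lerDl.
  by rewrite (le_trans _ (down _ _ nm))// lerDl.
have sa : has_sup (range a).
  by split; [exists (a 0%N), 0%N|exists (a 0%N + d / 2 ^+ 0) => _ [m _ <-]].
exists (sup (range a)) => n; apply/andP; split.
  by apply: ub_le_sup; [case: sa|exists n].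
by apply: ge_sup; [case: sa|move=> _ [m _ <-]].
Qed.

Section Rectangles.
Variables (f : C -> C) (A : R) (H V : R -> R -> C).
Hypothesis HE : forall y x, `|x| < A -> curve_derive (H y) x (f (of_reim x y)).
Hypothesis VE : forall x y, `|y| < A -> curve_derive (V x) y (ci * f (of_reim x y)).

(** The integral of [f] along the boundary of a rectangle, computed from
    primitives of [f] along horizontal and vertical lines: with this form its
    additivity is a ring identity. *)
Definition rect_integral x1 x2 y1 y2 : C :=
  (H y1 x2 - H y1 x1) + (V x2 y2 - V x2 y1)
  - (H y2 x2 - H y2 x1) - (V x1 y2 - V x1 y1).

(** The boundary integral of an affine function is zero, since it has a
    quadratic primitive; so only the distance to an affine function matters. *)
Lemma rect_integral_le x1 x2 y1 y2 (al be : C) (e : R) :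
  x1 <= x2 -> y1 <= y2 -> `|x1| < A -> `|x2| < A -> `|y1| < A -> `|y2| < A ->
  (forall x y, x1 <= x <= x2 -> y1 <= y <= y2 ->
     `|f (of_reim x y) - (al + be * of_reim x y)| <= of_real e) ->
  `|rect_integral x1 x2 y1 y2| <= of_real (4 * e * ((x2 - x1) + (y2 - y1))).
Proof.
move=> x12 y12 x1A x2A y1A y2A He.
pose P z := al * z + be / 2 * z ^+ 2.
have dP z : is_derive z 1 P (al + be * z).
  apply/is_derive_near => e0 e00.
  have e1 : 0 < e0 / (1 + `|be / 2|) by rewrite divr_gt0// ltr_wpDr.
  apply: filterS (near_dist_le z e1) => w.
  rewrite ler_pdivlMr ?ltr_wpDr// distrC => wz.
  rewrite (_ : _ - _ = be / 2 * (w - z) * (w - z)); last by rewrite /P; field.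
  rewrite normrM ler_wpM2r// normrM (le_trans _ wz)// mulrC ler_wpM2l//.
  by rewrite lerDr.
have lt_A a b t : `|a| < A -> `|b| < A -> a <= t <= b -> `|t| < A.
  rewrite !ltr_norml => /andP[? ?] /andP[? ?] /andP[? ?]; apply/andP; split; lra.
have hor y : y1 <= y <= y2 ->
    `|H y x2 - H y x1 - (P (of_reim x2 y) - P (of_reim x1 y))| <= of_real (2 * e * (x2 - x1)).
  move=> yy; rewrite (_ : _ - _ =
    (H y x2 - P (of_reim x2 y)) - (H y x1 - P (of_reim x1 y))); last by ring.
  apply: (@curve_mean_value _ (fun x => H y x - P (of_reim x y))
    (fun x => f (of_reim x y) - (al + be * of_reim x y)) x1 x2 e x12) => [x xx|x xx].
    apply: curve_deriveB; first exact/HE/(lt_A _ _ _ _ _ xx).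
    rewrite -[X in curve_derive _ _ X]mulr1.
    exact: (curve_derive_comp (dP _) (curve_derive_of_reiml _ _)).
  exact: He.
have ver x : x1 <= x <= x2 ->
    `|V x y2 - V x y1 - (P (of_reim x y2) - P (of_reim x y1))| <= of_real (2 * e * (y2 - y1)).
  move=> xx; rewrite (_ : _ - _ =
    (V x y2 - P (of_reim x y2)) - (V x y1 - P (of_reim x y1))); last by ring.
  apply: (@curve_mean_value _ (fun y => V x y - P (of_reim x y))
    (fun y => ci * (f (of_reim x y) - (al + be * of_reim x y))) y1 y2 e y12) => [y yy|y yy].
    rewrite mulrBr; apply: curve_deriveB; first exact/VE/(lt_A _ _ _ _ _ yy).
    rewrite [ci * (_ + _)]mulrC.
    exact: (curve_derive_comp (dP _) (curve_derive_of_reimr _ _)).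
  by rewrite normrM norm_ci mul1r; exact: He.
have h1 := hor y1 ltac:(by rewrite lexx).
have h2 := hor y2 ltac:(by rewrite lexx andbT).
have v1 := ver x1 ltac:(by rewrite lexx).
have v2 := ver x2 ltac:(by rewrite lexx andbT).
rewrite (_ : rect_integral _ _ _ _ =
  (H y1 x2 - H y1 x1 - (P (of_reim x2 y1) - P (of_reim x1 y1)))
  + (V x2 y2 - V x2 y1 - (P (of_reim x2 y2) - P (of_reim x2 y1)))
  - (H y2 x2 - H y2 x1 - (P (of_reim x2 y2) - P (of_reim x1 y2)))
  - (V x1 y2 - V x1 y1 - (P (of_reim x1 y2) - P (of_reim x1 y1)))); last first.
  by rewrite /rect_integral; ring.
apply: le_trans (ler_normB _ _) _; apply: le_trans (lerD (ler_normB _ _) v1) _.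
apply: le_trans (lerD (lerD (ler_normD _ _) h2) (lexx _)) _.
apply: le_trans (lerD (lerD (lerD h1 v2) (lexx _)) (lexx _)) _.
by rewrite -!of_realD le_of_real le_eqVlt; apply/orP; left; apply/eqP; ring.
Qed.

(** The boundary integral is the sum of the integrals over the four quarters of the
    rectangle. *)
Lemma rect_integral_quarter (x y dx dy : R) : exists p : R * R,
  [/\ p.1 = x \/ p.1 = x + dx / 2, p.2 = y \/ p.2 = y + dy / 2 &
   `|rect_integral x (x + dx) y (y + dy)| <=
   4 * `|rect_integral p.1 (p.1 + dx / 2) p.2 (p.2 + dy / 2)|].
Proof.
set x' := x + dx / 2; set y' := y + dy / 2.
have ex : x + dx = x' + dx / 2 by rewrite /x'; field.
have ey : y + dy = y' + dy / 2 by rewrite /y'; field.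
pose q a b := `|rect_integral a (a + dx / 2) b (b + dy / 2)|.
have sub4 : `|rect_integral x (x + dx) y (y + dy)| <=
    q x y + q x' y + q x y' + q x' y'.
  rewrite ex ey /q -/x' -/y'.
  rewrite (_ : rect_integral x _ y _ = rect_integral x x' y y'
    + rect_integral x' (x' + dx / 2) y y' + rect_integral x x' y' (y' + dy / 2)
    + rect_integral x' (x' + dx / 2) y' (y' + dy / 2)); last first.
    by rewrite /rect_integral; ring.
  apply: le_trans (ler_normD _ _) _; rewrite lerD2r.
  apply: le_trans (ler_normD _ _) _; rewrite lerD2r.
  exact: ler_normD.
apply: contrapT => Hn.
have small a b : a = x \/ a = x' -> b = y \/ b = y' ->
    q a b < `|rect_integral x (x + dx) y (y + dy)| / 4.
  move=> ha hb; rewrite real_ltNge ?realE ?normr_ge0 ?divr_ge0//.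
  apply/negP => Hq; apply: Hn; exists (a, b); split=> //=.
  by rewrite -ler_pdivrMl// mulrC.
have : q x y + q x' y + q x y' + q x' y' < `|rect_integral x (x + dx) y (y + dy)|.
  rewrite (_ : `|_| = let c := `|rect_integral x (x + dx) y (y + dy)| / 4 in
    c + c + c + c); last by move=> /=; field.
  by rewrite /= !ltrD// small; auto.
by move=> /(le_lt_trans sub4); rewrite ltxx.
Qed.

(** Repeated subdivision produces rectangles shrinking to a point, whose integral
    decreases at most like the square of their diameter. At that point [f] is
    affine up to a small multiple of the distance, so the integral is a small
    multiple of the square of the diameter: the integral one started from is 0. *)
Theorem goursat_rectangle x1 x2 y1 y2 :
  x1 <= x2 -> y1 <= y2 -> `|x1| < A -> `|x2| < A -> `|y1| < A -> `|y2| < A ->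
  (forall x y, x1 <= x <= x2 -> y1 <= y <= y2 -> exists d, is_derive (of_reim x y) 1 f d) ->
  rect_integral x1 x2 y1 y2 = 0.
Proof.
move=> x12 y12 x1A x2A y1A y2A df.
set dx := x2 - x1; set dy := y2 - y1.
have dx0 : 0 <= dx by rewrite subr_ge0.
have dy0 : 0 <= dy by rewrite subr_ge0.
have ex n : dx / 2 ^+ n.+1 = dx / 2 ^+ n / 2 by rewrite exprS; field; rewrite expf_neq0.
have ey n : dy / 2 ^+ n.+1 = dy / 2 ^+ n / 2 by rewrite exprS; field; rewrite expf_neq0.
have dxn n : 0 <= dx / 2 ^+ n by rewrite divr_ge0// exprn_ge0.
have dyn n : 0 <= dy / 2 ^+ n by rewrite divr_ge0// exprn_ge0.
have /choice[next Hnext] (q : nat * (R * R)) :=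
  rect_integral_quarter q.2.1 q.2.2 (dx / 2 ^+ q.1) (dy / 2 ^+ q.1).
pose p := fix p n := if n is m.+1 then next (m, p m) else (x1, y1).
have pS n : p n.+1 = next (n, p n) by [].
have sx n : (p n).1 <= (p n.+1).1 /\
    (p n.+1).1 + dx / 2 ^+ n.+1 <= (p n).1 + dx / 2 ^+ n.
  have [+ _ _] := Hnext (n, p n); rewrite -pS ex /=.
  move: (dxn n); set D := dx / _ => D0; case=> ->; split; lra.
have sy n : (p n).2 <= (p n.+1).2 /\
    (p n.+1).2 + dy / 2 ^+ n.+1 <= (p n).2 + dy / 2 ^+ n.
  have [_ + _] := Hnext (n, p n); rewrite -pS ey /=.
  move: (dyn n); set D := dy / _ => D0; case=> ->; split; lra.
have [a Ha] := nested_intervals dx0 (fun n => (sx n).1) (fun n => (sx n).2).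
have [b Hb] := nested_intervals dy0 (fun n => (sy n).1) (fun n => (sy n).2).
pose J n := rect_integral (p n).1 ((p n).1 + dx / 2 ^+ n)
                          (p n).2 ((p n).2 + dy / 2 ^+ n).
have J4 n : `|J 0%N| <= 4 ^+ n * `|J n|.
  elim: n => [|n IH]; first by rewrite expr0 mul1r.
  apply: le_trans IH _; rewrite exprSr -mulrA ler_wpM2l ?exprn_ge0//.
  have [_ _] := Hnext (n, p n); rewrite -pS /= /J.
  by rewrite ex ey.
have J0 : J 0%N = rect_integral x1 x2 y1 y2.
  by rewrite /J /= expr0 !divr1 /dx /dy ![_ + (_ - _)]addrC !subrK.
have inx n x : (p n).1 <= x <= (p n).1 + dx / 2 ^+ n -> x1 <= x <= x2.
  elim: n => [|n IH] /andP[h1 h2].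
    by move: h1 h2; rewrite /= expr0 divr1 /dx addrC subrK => -> ->.
  apply: IH; have [s1 s2] := sx n.
  by rewrite (le_trans s1)//= (le_trans h2).
have iny n y : (p n).2 <= y <= (p n).2 + dy / 2 ^+ n -> y1 <= y <= y2.
  elim: n => [|n IH] /andP[h1 h2].
    by move: h1 h2; rewrite /= expr0 divr1 /dy addrC subrK => -> ->.
  apply: IH; have [s1 s2] := sy n.
  by rewrite (le_trans s1)//= (le_trans h2).
have lt_A u v t : `|u| < A -> `|v| < A -> u <= t <= v -> `|t| < A.
  rewrite !ltr_norml => /andP[? ?] /andP[? ?] /andP[? ?]; apply/andP; split; lra.
have [d /is_derive_near Hd] := df a b (inx _ _ (Ha 0%N)) (iny _ _ (Hb 0%N)).
set S := dx + dy; have S0 : 0 <= S by rewrite addr_ge0.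
apply/eqP; rewrite -J0 -normr_le0 -of_real_norm.
rewrite -[0](@rmorph0 _ _ (@of_real R)) le_of_real.
apply/ler_addgt0Pr => e e0; rewrite add0r.
have e1 : 0 < e / (4 * (S ^+ 2 + 1)).
  by rewrite divr_gt0// mulr_gt0// ltr_wpDl// sqr_ge0.
have /Hd/nbhs_normP[r0 /= r0_gt0 Hr] : 0 < of_real (e / (4 * (S ^+ 2 + 1))).
  by rewrite of_real_gt0.
have rE := ge0_of_real (ltW r0_gt0).
have r1 : 0 < re r0 by rewrite -of_real_gt0 -rE.
have [n Sn] : exists n, S / 2 ^+ n < re r0.
  pose n := (Num.truncn (S / re r0)).+1; exists n.
  rewrite ltr_pdivrMr ?exprn_gt0// mulrC -ltr_pdivrMr//.
  apply: lt_le_trans (truncnS_gt _) _; rewrite -natrX ler_nat.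
  exact/ltnW/ltn_expl.
have Sdiv : dx / 2 ^+ n + dy / 2 ^+ n = S / 2 ^+ n by rewrite -mulrDl.
have := @rect_integral_le (p n).1 ((p n).1 + dx / 2 ^+ n) (p n).2
  ((p n).2 + dy / 2 ^+ n) (f (of_reim a b) - d * of_reim a b) d
  (e / (4 * (S ^+ 2 + 1)) * (S / 2 ^+ n)).
have px1 : x1 <= (p n).1 <= x2 by apply: (inx n); rewrite lexx lerDl dxn.
have px2 : x1 <= (p n).1 + dx / 2 ^+ n <= x2 by apply: (inx n); rewrite lexx lerDl dxn.
have py1 : y1 <= (p n).2 <= y2 by apply: (iny n); rewrite lexx lerDl dyn.
have py2 : y1 <= (p n).2 + dy / 2 ^+ n <= y2 by apply: (iny n); rewrite lexx lerDl dyn.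
rewrite !lerDl dxn dyn => /(_ isT isT (lt_A _ _ _ x1A x2A px1)
  (lt_A _ _ _ x1A x2A px2) (lt_A _ _ _ y1A y2A py1) (lt_A _ _ _ y1A y2A py2)).
have Hxy x y : (p n).1 <= x <= (p n).1 + dx / 2 ^+ n ->
    (p n).2 <= y <= (p n).2 + dy / 2 ^+ n ->
    `|of_reim x y - of_reim a b| <= of_real (S / 2 ^+ n).
  move=> xx yy; rewrite of_reimB (le_trans (norm_of_reim _ _))// le_of_real -Sdiv lerD//.
    exact: itv_dist_le xx (Ha n).
  exact: itv_dist_le yy (Hb n).
move=> Hle; have {}Hle : `|J n| <= of_real (4 * (e / (4 * (S ^+ 2 + 1)) * (S / 2 ^+ n)) *
    (S / 2 ^+ n)).
  rewrite [X in of_real (_ * X)](_ : _ = ((p n).1 + dx / 2 ^+ n - (p n).1) +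
    ((p n).2 + dy / 2 ^+ n - (p n).2)); last by rewrite -Sdiv; ring.
  apply: Hle => x y xx yy.
  have zd := Hxy x y xx yy.
  rewrite (_ : _ - _ = f (of_reim x y) - f (of_reim a b) - d * (of_reim x y - of_reim a b)); last by ring.
  apply: le_trans (Hr _ _) _.
    by rewrite /= distrC (le_lt_trans zd)// rE lt_of_real.
  by rewrite [leRHS]of_realM ler_wpM2l// of_real_ge0 ltW.
rewrite -le_of_real of_real_norm.
apply: le_trans (J4 n) _; apply: le_trans (ler_wpM2l _ Hle) _; first by rewrite exprn_ge0.
rewrite (_ : 4 ^+ n = of_real (4 ^+ n)); last by rewrite rmorphXn /= rmorph_nat.
rewrite -of_realM le_of_real.
rewrite [leLHS](_ : _ = e * (S ^+ 2 / (S ^+ 2 + 1))); last first.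
  rewrite (_ : 4 ^+ n = 2 ^+ n * 2 ^+ n); last by rewrite -exprMn -natrM.
  by field; rewrite expf_neq0 ?gt_eqF// ltr_wpDl ?sqr_ge0.
apply: ler_piMr; first exact: ltW.
have S1 : 0 < S ^+ 2 + 1 by rewrite ltr_wpDl// sqr_ge0.
by rewrite ler_pdivrMr// mul1r lerDl.
Qed.

End Rectangles.
End Goursat.

(** * Primitives on a disc *)

Section Primitives.
Context {R : realType}.
Notation C := (CC R).
Implicit Types (f F : C -> C) (r s : R) (z w : C).

Lemma is_derive_differentiable f z d : is_derive z 1 f d -> differentiable f z.
Proof. by move=> [fz _]; apply/derivable1_diffP. Qed.

Lemma differentiable_is_derive f z : differentiable f z -> is_derive z 1 f (derive1 f z).
Proof.
by move=> /derivable1_diffP fz; rewrite derive1E; exact: derivableP.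
Qed.

Lemma is_derive_derive1 f z (d : C) : is_derive z 1 f d -> derive1 f z = d.
Proof. by move=> fz; rewrite derive1E; exact: derive_val. Qed.

Lemma norm_of_reim_lt (x y u v : R) (s : C) :
  u ^+ 2 <= x ^+ 2 -> v ^+ 2 <= y ^+ 2 -> `|of_reim x y| < s -> `|of_reim u v| < s.
Proof.
move=> ux vy; apply: le_lt_trans.
by rewrite !normE le_of_real !re_of_reim !im_of_reim ler_wsqrtr// lerD.
Qed.

(** The primitive integrates [f] along a horizontal and then a vertical segment
    from 0. By Goursat's theorem for the rectangle between [z] and [w], moving from
    [z] to [w] also amounts to a horizontal and a vertical step, on which [f] is
    close to [f z]. *)
Lemma disc_primitive_continuous f s : continuous f ->
  holomorphic_on (disc (of_real s)) f ->
  exists F, forall z, disc (of_real s) z -> is_derive z 1 F (f z).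
Proof.
move=> cf df.
have cH (y : R) : continuous (fun x => f (of_reim x y)).
  by move=> x; apply: continuous_comp; [exact: continuous_of_reiml|exact: cf].
have cV (x : R) : continuous (fun y => ci * f (of_reim x y)).
  move=> y; apply: cvgMr; apply: (@continuous_comp _ _ _ (of_reim x) f).
    exact: continuous_of_reimr.
  exact: cf.
have /choice[H HE] (y : R) := curve_primitive s (cH y).
have /choice[V VE] (x : R) := curve_primitive s (cV x).
pose J := rect_integral H V.
have abs_lt (x y : R) : disc (of_real s) (of_reim x y) -> `|x| < s /\ `|y| < s.
  rewrite /disc /= => xys; rewrite -!lt_of_real; split; apply: le_lt_trans xys.
    by have := norm_re (of_reim x y); rewrite re_of_reim.
  by have := norm_im (of_reim x y); rewrite im_of_reim.
have J0 x1 x2 y : disc (of_real s) (of_reim x1 y) -> disc (of_real s) (of_reim x2 y) ->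
    J x1 x2 0 y = 0.
  wlog x12 : x1 x2 / x1 <= x2.
    move=> W d1 d2; have [/W|/ltW /W] := leP x1 x2; first exact.
    move=> /(_ d2 d1) J0; rewrite -[LHS]opprK -[RHS]oppr0; congr (- _).
    by rewrite -J0 /J /rect_integral; ring.
  move=> d1 d2; have [x1s ys] := abs_lt _ _ d1; have [x2s _] := abs_lt _ _ d2.
  have s0 : `|0 : R| < s by rewrite normr0; apply: le_lt_trans ys.
  have in_disc x y' : x1 <= x <= x2 -> y' ^+ 2 <= y ^+ 2 ->
      exists d, is_derive (of_reim x y') 1 f d.
    move=> /andP[h1 h2] yy; exists (derive1 f (of_reim x y')).
    apply/differentiable_is_derive/df; have [x0|x0] := leP 0 x.
      by apply: norm_of_reim_lt d2 => //; rewrite ler_sqr ?nnegrE// (le_trans x0).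
    apply: norm_of_reim_lt d1 => //; rewrite -sqrrN -[leRHS]sqrrN ler_sqr ?nnegrE; lra.
  have [y0|/ltW y0] := leP 0 y.
    apply: (goursat_rectangle HE VE) => // x y' xx /andP[h1 h2].
    by apply: in_disc => //; rewrite ler_sqr ?nnegrE.
  rewrite -[LHS]opprK -[RHS]oppr0; congr (- _).
  rewrite (_ : - _ = J x1 x2 y 0); last by rewrite /J /rect_integral; ring.
  apply: (goursat_rectangle HE VE) => // x y' xx /andP[h1 h2].
  apply: in_disc => //; rewrite -sqrrN -[leRHS]sqrrN ler_sqr ?nnegrE; lra.
exists (fun z => (H 0 (re z) - H 0 0) + (V (re z) (im z) - V (re z) 0)) => z zs.
apply/is_derive_near => e e0; have eE := ge0_of_real (ltW e0).
have e4 : 0 < re e / 4 by rewrite divr_gt0// -of_real_gt0 -eE.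
have e4' : 0 < of_real (re e / 4) by rewrite of_real_gt0.
have := cf z; move/(@cvgrPdist_le _ _ _ (nbhs z))/(_ _ e4').
move=> /nbhs_normP[d /= d0 Hd].
have sz : 0 < (of_real s - `|z|) / 3 by rewrite divr_gt0// subr_gt0.
have d2 : 0 < d / 3 by rewrite divr_gt0.
apply: filterS2 (near_dist_le z sz) (near_dist_le z d2) => w.
rewrite distrC => ws wd.
set x := re z; set y := im z; set x' := re w; set y' := im w.
have zE : z = of_reim x y by rewrite reim_of_reim.
have wE : w = of_reim x' y' by rewrite reim_of_reim.
have hx : of_real `|x' - x| <= `|w - z| by rewrite -reN -reD norm_re.
have hy : of_real `|y' - y| <= `|w - z| by rewrite -imN -imD norm_im.
have two_thirds (a : C) : 0 < a -> a / 3 + a / 3 < a.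
  move=> a0; rewrite -subr_gt0 (_ : _ - _ = a / 3) ?divr_gt0//.
  by field.
have near_disc v : `|v - z| <= `|w - z| + `|w - z| -> disc (of_real s) v.
  move=> vz; rewrite /disc /= -(subrK z v) (le_lt_trans (ler_normD _ _))//.
  rewrite -ltrBrDr (le_lt_trans vz)// (le_lt_trans (lerD ws ws))//.
  by rewrite two_thirds// subr_gt0.
have near_f v : `|v - z| <= `|w - z| + `|w - z| -> `|f v - f z| <= of_real (re e / 4).
  move=> vz; rewrite distrC; apply: Hd; rewrite /= distrC (le_lt_trans vz)//.
  by rewrite (le_lt_trans (lerD wd wd))// two_thirds.
have near_h u : `|u - x| <= `|x' - x| -> `|of_reim u y - z| <= `|w - z| + `|w - z|.
  move=> ux; rewrite [X in `|_ - X|]zE of_reimB subrr (le_trans (norm_of_reim _ _))// normr0 addr0.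
  by rewrite -[leLHS]addr0 lerD// (le_trans _ hx)// le_of_real.
have near_v v : `|v - y| <= `|y' - y| -> `|of_reim x' v - z| <= `|w - z| + `|w - z|.
  move=> vy; rewrite [X in `|_ - X|]zE of_reimB (le_trans (norm_of_reim _ _))// of_realD lerD//.
  by rewrite (le_trans _ hy)// le_of_real.
have dx'y : disc (of_real s) (of_reim x' y) by apply/near_disc/near_h.
have := J0 x x' y; rewrite -zE => /(_ zs dx'y) Jxy.
rewrite (_ : _ - _ = (H y x' - H y x - f z * (of_real (x' - x)))
   + (V x' y' - V x' y - ci * f z * of_real (y' - y)) + J x x' 0 y); last first.
  have -> : w - z = of_real (x' - x) + ci * of_real (y' - y).
    by rewrite [in LHS]wE [in LHS]zE of_reimB.
  by rewrite /J /rect_integral; ring.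
rewrite Jxy addr0 (le_trans (ler_normD _ _))//.
have estH : `|H y x' - H y x - f z * (of_real (x' - x))| <=
    of_real (2 * (re e / 4) * `|x' - x|).
  rewrite (_ : _ - _ = (H y x' - f z * of_real x') - (H y x - f z * of_real x)); last first.
    by rewrite of_realB; ring.
  apply: (@curve_mean_value_abs _ (fun u => H y u - f z * of_real u)
    (fun u => f (of_reim u y) - f z)) => u ux.
    rewrite -[f z in X in curve_derive _ _ X]mulr1; apply: curve_deriveB; last first.
      by apply: curve_deriveZ; exact: curve_derive_of_real.
    by apply: HE; apply: (abs_lt _ y _).1; exact/near_disc/near_h.
  exact/near_f/near_h.
have estV : `|V x' y' - V x' y - ci * f z * (of_real (y' - y))| <=
    of_real (2 * (re e / 4) * `|y' - y|).
  rewrite (_ : _ - _ = (V x' y' - ci * f z * of_real y') - (V x' y - ci * f z * of_real y)); last first.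
    by rewrite of_realB; ring.
  apply: (@curve_mean_value_abs _ (fun v => V x' v - ci * f z * of_real v)
    (fun v => ci * (f (of_reim x' v) - f z))) => v vy.
    rewrite mulrBr -[ci * f z in X in curve_derive _ _ X]mulr1; apply: curve_deriveB; last first.
      by apply: curve_deriveZ; exact: curve_derive_of_real.
    by apply: VE; apply: (abs_lt x' _ _).2; exact/near_disc/near_v.
  by rewrite normrM norm_ci mul1r; exact/near_f/near_v.
apply: le_trans (lerD estH estV) _.
rewrite -of_realD -mulrDr.
apply: (@le_trans _ _ (of_real (re e / 2) * (`|w - z| + `|w - z|))).
  rewrite (_ : 2 * (re e / 4) = re e / 2); last by field.
  rewrite of_realM; apply: ler_wpM2l; last by rewrite of_realD lerD.
  by rewrite of_real_ge0 divr_ge0// -of_real_ge0 -eE ltW.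
rewrite (_ : of_real (re e / 2) = e / 2); last by rewrite [in RHS]eE of_realM fmorphV rmorph_nat.
by rewrite le_eqVlt; apply/orP; left; apply/eqP; field.
Qed.

(** Composing with this retraction extends a function from a disc to a continuous
    function on the plane, so that it can be integrated along whole lines. *)
Lemma disc_retraction s : 0 < s -> exists p : C -> C,
  [/\ continuous p, forall z, `|p z| <= of_real s &
      forall z, `|z| <= of_real s -> p z = z].
Proof.
move=> s0; pose S := of_real s.
pose m z : C := (S + `|z| + `|S - `|z| |) / 2.
have mE z : m z = of_real (Num.max s (re `|z|)).
  rewrite /m -[`|z|]of_real_norm -of_realB -of_realD norm_of_real -of_realD.
  rewrite re_of_real; set n := re `|z|; have [sz|zs] := leP s n.
    by rewrite ler0_norm ?subr_le0// opprB addrC addrA subrK of_realD; field.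
  by rewrite gtr0_norm ?subr_gt0// (_ : s + n + (s - n) = s + s) ?of_realD -/S; [field|ring].
have m0 z : 0 < Num.max s (re `|z|) by rewrite lt_max s0.
have cS (z : C) (c : C) : c @[_ --> z] --> c by exact: (@cvg_cst _ _ _ (nbhs z)).
have cn (z : C) : `|w| @[w --> z] --> `|z|.
  exact: (@cvg_norm _ _ _ (nbhs z) _ _ _ (@cvg_id _ (nbhs z))).
have cm : continuous m.
  move=> z; rewrite /m; apply: (@cvgM _ _ (nbhs z)); last exact: cS.
  apply: (@cvgD _ _ _ (nbhs z)).
    by apply: (@cvgD _ _ _ (nbhs z)); [exact: cS|exact: cn].
  apply: (@cvg_norm _ _ _ (nbhs z)).
  exact: (@cvgB _ _ _ (nbhs z) _ _ _ _ _ (cS z S) (cn z)).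
exists (fun z => z * (S / m z)); split.
- move=> z; apply: (@cvgM _ _ (nbhs z)); first exact: (@cvg_id _ (nbhs z)).
  apply: (@cvgM _ _ (nbhs z)); first exact: cS.
  by apply: (@cvgV _ _ (nbhs z)); [rewrite mE of_real_eq0 gt_eqF|exact: cm].
- move=> z; rewrite mE -fmorphV -of_realM normrM norm_of_real -of_real_norm.
  rewrite -of_realM le_of_real.
  have -> : `|s / Num.max s (re `|z|)| = s / Num.max s (re `|z|).
    by rewrite ger0_norm// divr_ge0// ltW.
  rewrite mulrA ler_pdivrMr// mulrC; apply: ler_wpM2l; first exact: ltW.
  by rewrite le_max lexx orbT.
- move=> z; rewrite -of_real_norm le_of_real => zs.
  by rewrite mE (max_idPl zs) divff ?mulr1// of_real_eq0 gt_eqF.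
Qed.

Lemma holomorphic_primitive f r s : 0 < s -> s < r ->
  holomorphic_on (disc (of_real r)) f ->
  exists F, forall z, disc (of_real s) z -> is_derive z 1 F (f z).
Proof.
move=> s0 sr df; have [p [cp ps pid]] := disc_retraction s0.
have fpE z : `|z| <= of_real s -> f (p z) = f z by move=> /pid ->.
have [||F HF] := @disc_primitive_continuous (f \o p) s.
- move=> z; apply: continuous_comp; first exact: cp.
  apply: differentiable_continuous; apply: df.
  by rewrite /disc /= (le_lt_trans (ps _))// lt_of_real.
- move=> z zs; have /differentiable_is_derive fz : differentiable f z.
    by apply: df; rewrite /disc /= (lt_trans zs)// lt_of_real.
  apply: is_derive_differentiable.
  apply: near_eq_is_derive fz.
  by apply: filterS (near_disc zs) => w ws; rewrite /= fpE// ltW.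
- exists F => z zs; have := HF z zs; rewrite /= fpE//.
  exact: ltW.
Qed.
End Primitives.

(** * Mean value inequality and difference quotients *)

Section DerivativeRules.
Variable K : numFieldType.
Implicit Types (f g : K -> K) (z a b c : K).

Lemma is_derive1D f g z a b : is_derive z 1 f a -> is_derive z 1 g b ->
  is_derive z 1 (fun w => f w + g w) (a + b).
Proof. exact: is_deriveD. Qed.

Lemma is_derive1M f g z a b : is_derive z 1 f a -> is_derive z 1 g b ->
  is_derive z 1 (fun w => f w * g w) (a * g z + f z * b).
Proof.
by move=> fa gb; have := is_deriveM fa gb; rewrite addrC [g z *: a]mulrC.
Qed.

Lemma is_derive1Z c f z a : is_derive z 1 f a ->
  is_derive z 1 (fun w => c * f w) (c * a).
Proof. exact: (@is_deriveZ _ K K f c z 1 a). Qed.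

Lemma is_derive1B f g z a b : is_derive z 1 f a -> is_derive z 1 g b ->
  is_derive z 1 (fun w => f w - g w) (a - b).
Proof. exact: is_deriveB. Qed.

Lemma is_derive1V f z a : f z != 0 -> is_derive z 1 f a ->
  is_derive z 1 (fun w => (f w)^-1) (- a / f z ^+ 2).
Proof.
move=> fz0 [fz <-]; split; first exact: derivableV.
by rewrite deriveV// -[_ *: _]/(_ * _) mulrC mulrN mulNr.
Qed.

Lemma is_derive1_subr c z : is_derive z 1 (fun w => w - c) 1.
Proof.
have := is_derive1B (is_derive_id z 1) (is_derive_cst c z 1).
by rewrite subr0.
Qed.

Lemma is_derive1_unique f z a b : is_derive z 1 f a -> is_derive z 1 f b -> a = b.
Proof. by move=> [_ <-] [_ <-]. Qed.

End DerivativeRules.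

Section SegmentMeanValue.
Context {R : realType}.
Notation C := (CC R).
Implicit Types (F : C -> C) (z w a b : C).

Definition segment a b (t : R) : C := a + of_real t * (b - a).

Lemma curve_derive_segment a b t : curve_derive (segment a b) t (b - a).
Proof.
rewrite -[b - a]add0r; apply: curve_deriveD; first exact: curve_derive_cst.
have -> : (fun s => of_real s * (b - a)) = (fun s => (b - a) * of_real s).
  by apply/funext => s; rewrite mulrC.
rewrite -[X in curve_derive _ _ X]mulr1.
by apply: curve_deriveZ; exact: curve_derive_of_real.
Qed.

Lemma segment_dist a b t : 0 <= t <= 1 -> `|segment a b t - a| <= `|b - a|.
Proof.
move=> /andP[t0 t1]; rewrite /segment addrC addKr normrM norm_of_real.
by rewrite ler_piMl// ger0_norm// -[1]/(of_real 1) le_of_real.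
Qed.

Lemma segment_mean_value F (d : R -> C) a b (M : C) :
  (forall t, 0 <= t <= 1 -> is_derive (segment a b t) 1 F (d t)) ->
  (forall t, 0 <= t <= 1 -> `|d t| <= M) -> `|F b - F a| <= 2 * M * `|b - a|.
Proof.
move=> HF HM; have M0 : 0 <= M.
  by apply: le_trans (normr_ge0 (d 0)) (HM 0 _); rewrite lexx ler01.
have := @curve_mean_value R (fun t => F (segment a b t))
  (fun t => d t * (b - a)) 0 1 (re M * re `|b - a|) ler01.
rewrite /segment mul0r addr0 rmorph1 mul1r [a + _]addrC subrK subr0 mulr1.
move=> H; apply: le_trans (H _ _) _ => [t t01|t t01|].
- exact: curve_derive_comp (HF t t01) (curve_derive_segment a b t).
- rewrite of_realM of_real_norm -ge0_of_real// normrM ler_wpM2r//.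
  exact: HM.
- by rewrite !of_realM of_real_norm -ge0_of_real// rmorph_nat mulrA.
Qed.

Lemma derive0_constant F (s : C) : (forall z, disc s z -> is_derive z 1 F 0) ->
  forall z, disc s z -> F z = F 0.
Proof.
move=> dF z zs; apply/eqP; rewrite -subr_eq0 -normr_le0.
suff : `|F z - F 0| <= 2 * 0 * `|z - 0| by rewrite mulr0 mul0r.
apply: (@segment_mean_value F (fun=> 0)) => [t t01|t t01]; last by rewrite normr0.
apply: dF; rewrite /disc /= -[segment _ _ _]subr0.
by rewrite (le_lt_trans (segment_dist _ _ t01))// subr0.
Qed.

(** The difference between [F] and its second order Taylor polynomial has the
    derivative [f z - f w - d * (z - w)], which is small compared with [z - w]. *)
Lemma second_order_taylor F (f : C -> C) w (d : C) :
  (\forall z \near w, is_derive (z : C) 1 F (f z)) -> is_derive w 1 f d ->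
  forall e, 0 < e -> \forall z \near w,
    `|F z - F w - f w * (z - w) - d / 2 * (z - w) ^+ 2| <= e * `|z - w| ^+ 2.
Proof.
move=> dF /is_derive_near df e e0; have e2 : 0 < e / 2 by rewrite divr_gt0.
have /nbhs_normP[r /= r0 Hr] : \forall z \near w, is_derive (z : C) 1 F (f z) /\
    `|f z - f w - d * (z - w)| <= e / 2 * `|z - w|.
  by apply: filterS2 dF (df _ e2) => z.
apply/nbhs_normP; exists r => //= z zr.
pose G v := F v - f w * (v - w) - d / 2 * (v - w) ^+ 2.
have in_r t : 0 <= t <= 1 -> ball_ Num.Def.normr w r (segment w z t).
  move=> t01; rewrite /ball_ /= distrC (le_lt_trans (segment_dist _ _ t01))//.
  by rewrite distrC.
rewrite (_ : _ - _ = G z - G w); last by rewrite /G; ring.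
rewrite (_ : e * _ = 2 * (e / 2 * `|z - w|) * `|z - w|); last by field.
apply: (@segment_mean_value G
  (fun t => f (segment w z t) - f w - d * (segment w z t - w))) => t t01.
  have [dFt _] := Hr _ (in_r t t01); set v := segment w z t in dFt *.
  have did c := is_derive1_subr c v.
  have := is_derive1B (is_derive1B dFt (is_derive1Z (f w) (did w)))
    (is_derive1Z (d / 2) (is_derive1M (did w) (did w))).
  by congr (is_derive _ _ _ _); rewrite mulr1 mul1r; field.
have [_ /le_trans] := Hr _ (in_r t t01); apply.
by apply: ler_wpM2l; [exact: ltW|exact: segment_dist].
Qed.

Definition slope F w (d : C) z := if z == w then d else (F z - F w) / (z - w).

(** A function whose derivative is differentiable at [w] has a difference quotient
    which is differentiable at [w] too. Therefore Goursat's theorem applies to this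
    quotient without any exceptional point. *)
Lemma slope_derive F (f : C -> C) w (d : C) :
  (\forall z \near w, is_derive (z : C) 1 F (f z)) -> is_derive w 1 f d ->
  is_derive w 1 (slope F w (f w)) (d / 2).
Proof.
move=> dF df; apply/is_derive_near => e e0.
apply: filterS (second_order_taylor dF df e0) => z Hz.
rewrite /slope eqxx; have [->|zw] := eqVneq z w.
  by rewrite !subrr mulr0 subrr normr0 mulr0.
have zw0 : z - w != 0 by rewrite subr_eq0.
have zw1 : 0 < `|z - w| by rewrite normr_gt0.
rewrite -(ler_pM2r zw1) -[leLHS]normrM -[leRHS]mulrA -expr2 (le_trans _ Hz)//.
by rewrite le_eqVlt; apply/orP; left; apply/eqP; congr `|_|; field.
Qed.

Lemma slope_holomorphic F (r : C) w : disc r w ->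
  holomorphic_on (disc r) F -> holomorphic_on (disc r) (derive1 F) ->
  holomorphic_on (disc r) (slope F w (derive1 F w)).
Proof.
move=> wr dF ddF z zr; have [->|zw] := eqVneq z w.
  have ddFw := differentiable_is_derive (ddF _ wr).
  apply: is_derive_differentiable; apply: slope_derive ddFw.
  by apply: filterS (near_disc wr) => v vr; exact/differentiable_is_derive/dF.
have /differentiable_is_derive dFz := dF _ zr.
have did c := is_derive1_subr c z.
have zw0 : z - w != 0 by rewrite subr_eq0.
have := is_derive1M
  (is_derive1B dFz (is_derive_cst (F w) z 1)) (is_derive1V (f := fun v => v - w) zw0 (did w)).
move=> Hd; apply: is_derive_differentiable; apply: (near_eq_is_derive _ Hd).
have zw1 : 0 < `|z - w| / 2 by rewrite divr_gt0// normr_gt0.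
apply: filterS (near_dist_le z zw1) => v vz; rewrite /slope.
case: eqVneq => // vw; move: vz; rewrite vw ler_pdivlMr//.
by rewrite ger_pMr ?normr_gt0// lern1.
Qed.

End SegmentMeanValue.

(** * Cauchy's formula *)

Lemma cvg_exprn (K : numFieldType) (T : Type) (F : set_system T) {FF : Filter F}
    (f : T -> K) (a : K) n :
  f x @[x --> F] --> a -> f x ^+ n @[x --> F] --> a ^+ n.
Proof.
move=> fa; elim: n => [|n IH]; first exact: cvg_cst.
rewrite exprS (_ : (fun x => _) = f \* (fun x => f x ^+ n)); first exact: cvgM.
by apply/funext => x; rewrite exprS.
Qed.

Section CircleMean.
Context {R : realType}.
Notation C := (CC R).
Implicit Types (f F : C -> C) (s : R) (z w : C).

Definition circ s (t : R) : C := of_real s * of_reim (cos t) (sin t).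

Lemma norm_circ s t : 0 <= s -> `|circ s t| = of_real s.
Proof.
move=> s0; rewrite normrM norm_of_real [`|s|]ger0_norm// normE re_of_reim im_of_reim cos2Dsin2.
by rewrite sqrtr1 mulr1.
Qed.

Lemma circ_2pi s : circ s (pi *+ 2) = circ s 0.
Proof. by rewrite /circ cos2pi sin2pi cos0 sin0. Qed.

Lemma curve_derive_circ s t : curve_derive (circ s) t (ci * circ s t).
Proof.
rewrite /circ mulrCA; apply: curve_deriveZ; apply/curve_derive_reim; split.
- rewrite (_ : _ \o _ = cos); last by apply/funext => u; rewrite /= re_of_reim.
  by rewrite reM re_of_reim im_of_reim re_ci im_ci mul0r mul1r sub0r; exact: is_derive_cos.
- rewrite (_ : _ \o _ = sin); last by apply/funext => u; rewrite /= im_of_reim.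
  by rewrite imM re_of_reim im_of_reim re_ci im_ci mul0r mul1r add0r; exact: is_derive_sin.
Qed.

Lemma continuous_circ s : continuous (circ s).
Proof. by move=> t; exact: curve_derive_continuous (curve_derive_circ s t). Qed.

(** The interval contains the period from 0 to [pi *+ 2], as [pi < 4]. *)
Definition primitive8 (g G : R -> C) := forall t, `|t| < 8 -> curve_derive G t (g t).

Lemma period_lt8 t : 0 <= t <= pi *+ 2 -> `|t| < (8 : R).
Proof.
move=> /andP[t0 t2]; rewrite ger0_norm// (le_lt_trans t2)// mulr2n.
have := @pihalf_lt2 R; rewrite ltr_pdivrMr// => p4; lra.
Qed.

Lemma period_ge0 : (0 : R) <= pi *+ 2.
Proof. by rewrite mulrn_wge0// pi_ge0. Qed.

(** The mean of [g] over one period, defined as the increment of any primitive,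
    which makes linearity immediate. *)
Definition period_mean (g : R -> C) : C :=
  get [set I | exists2 G, primitive8 g G &
               I = (G (pi *+ 2) - G 0) / of_real (pi *+ 2)].

Lemma of_real_2pi_neq0 : of_real (pi *+ 2) != 0 :> C.
Proof. by rewrite of_real_eq0 mulrn_eq0/= gt_eqF// pi_gt0. Qed.

Lemma period_meanE g G : primitive8 g G ->
  period_mean g = (G (pi *+ 2) - G 0) / of_real (pi *+ 2).
Proof.
move=> gG; rewrite /period_mean; case: xgetP => [I -> [H gH ->]|/(_ _)/forall2NP H].
  congr (_ / _); apply/eqP; rewrite -subr_eq0 -normr_le0.
  rewrite (_ : _ - _ = (H (pi *+ 2) - G (pi *+ 2)) - (H 0 - G 0)); last by ring.
  have := @curve_mean_value R (fun t => H t - G t) (fun=> 0) 0 (pi *+ 2) 0 period_ge0.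
  rewrite mulr0 mul0r; apply=> t /period_lt8 t8; last by rewrite normr0.
  by rewrite -[0](subrr (g t)); apply: curve_deriveB; [exact: gH|exact: gG].
by have [] := H ((G (pi *+ 2) - G 0) / of_real (pi *+ 2)) G.
Qed.

Lemma continuous_primitive8 g : continuous g -> exists G, primitive8 g G.
Proof. by move=> cg; exact: curve_primitive 8 cg. Qed.

Lemma period_mean_linear (c : C) g1 g2 : continuous g1 -> continuous g2 ->
  period_mean (fun t => c * g1 t + g2 t) = c * period_mean g1 + period_mean g2.
Proof.
move=> /continuous_primitive8[G1 H1] /continuous_primitive8[G2 H2].
rewrite (period_meanE H1) (period_meanE H2).
rewrite (@period_meanE _ (fun t => c * G1 t + G2 t)); last first.
  move=> t t8; apply: curve_deriveD; last exact: H2.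
  by apply: curve_deriveZ; exact: H1.
ring.
Qed.

Lemma period_mean_le g (M : C) : continuous g ->
  (forall t, 0 <= t <= pi *+ 2 -> `|g t| <= M) -> `|period_mean g| <= 2 * M.
Proof.
move=> /continuous_primitive8[G HG] HM; rewrite (period_meanE HG).
have M0 : 0 <= M.
  by apply: le_trans (normr_ge0 (g 0)) (HM 0 _); rewrite lexx period_ge0.
have p0 : 0 < of_real (pi *+ 2) :> C by rewrite of_real_gt0 pmulrn_lgt0// pi_gt0.
rewrite normrM normfV [`|of_real _|]gtr0_norm// ler_pdivrMr//.
have := @curve_mean_value R G g 0 (pi *+ 2) (re M) period_ge0.
rewrite subr0 !of_realM -(ge0_of_real M0) rmorph_nat; apply=> t tp.
  exact/HG/period_lt8.
by rewrite HM.
Qed.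

Lemma period_mean_cst (c : C) : period_mean (fun=> c) = c.
Proof.
rewrite (@period_meanE _ (fun t => c * of_real t)).
  by rewrite rmorph0 mulr0 subr0 mulfK// of_real_2pi_neq0.
move=> t _; rewrite -[X in curve_derive _ _ X]mulr1.
by apply: curve_deriveZ; exact: curve_derive_of_real.
Qed.

(** The circle is closed: a primitive takes the same value at both ends. *)
Lemma period_mean_exact s (F f : C -> C) :
  (forall t, is_derive (circ s t) 1 F (f (circ s t))) ->
  period_mean (fun t => f (circ s t) * circ s t) = 0.
Proof.
have ci0 : ci != 0 :> C by rewrite -normr_eq0 norm_ci oner_eq0.
move=> dF; rewrite (@period_meanE _ (fun t => ci^-1 * F (circ s t))).
  by rewrite circ_2pi subrr mul0r.
move=> t _; have := curve_deriveZ ci^-1 (curve_derive_comp (dF t) (curve_derive_circ s t)).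
by congr curve_derive; field.
Qed.

Lemma continuous_norm_bound (g : R -> C) : continuous g -> exists2 M : C, 0 <= M &
  forall t, 0 <= t <= pi *+ 2 -> `|g t| <= M.
Proof.
move=> cg; have cn : continuous (fun t => re `|g t|).
  move=> t; apply: (@continuous_comp _ _ _ (fun t => `|g t|) re).
    by apply: cvg_norm; exact: cg.
  exact: continuous_re.
have [c _ Hc] := EVT_max period_ge0 (continuous_subspaceT (A := `[0, pi *+ 2]) cn).
exists `|g c| => // t tp; rewrite -[`|g t|]of_real_norm -[`|g c|]of_real_norm.
by rewrite le_of_real Hc// in_itv.
Qed.

(** The constant depends only on the bound [B] of the arguments. *)
Lemma expr_taylor (K : numDomainType) (B : K) k : 0 <= B ->
  exists2 A, 0 <= A & forall u v : K, `|u| <= B -> `|v| <= B ->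
    `|v ^+ k - u ^+ k - k%:R * u ^+ k.-1 * (v - u)| <= A * `|v - u| ^+ 2.
Proof.
move=> B0; elim: k => [|k [A A0 IH]].
  by exists 0 => // u v _ _; rewrite !expr0 subrr !mul0r subrr normr0.
exists (B * A + k%:R * B ^+ k.-1).
  by rewrite addr_ge0 ?mulr_ge0 ?exprn_ge0 ?ler0n.
move=> u v uB vB.
rewrite (_ : _ - _ = v * (v ^+ k - u ^+ k - k%:R * u ^+ k.-1 * (v - u))
  + k%:R * u ^+ k.-1 * (v - u) ^+ 2); last first.
  by case: k {IH} => [|k] /=; rewrite !(exprS, expr0) -?natr1; ring.
rewrite (le_trans (ler_normD _ _))// mulrDl lerD//.
  by rewrite normrM -[leRHS]mulrA ler_pM// IH.
rewrite normrM normrX ler_wpM2r// normrM normr_nat ler_wpM2l ?ler0n//.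
by rewrite normrX lerXn2r// nnegrE.
Qed.

(** Cauchy type integral over the circle of radius [s], with density [phi]. *)
Definition cauchy_mean s k (phi : R -> C) w :=
  period_mean (fun t => phi t * (circ s t - w)^-1 ^+ k).

Section CauchyMean.
Variables (s : R) (s0 : 0 < s) (phi : R -> C) (cphi : continuous phi).

Lemma circ_sub_neq0 t w : `|w| < of_real s -> circ s t - w != 0.
Proof.
move=> ws; rewrite subr_eq0; apply/eqP => cw; move: ws.
by rewrite -cw norm_circ ?ltxx// ltW.
Qed.

Lemma norm_circ_sub t w : of_real s - `|w| <= `|circ s t - w|.
Proof.
by rewrite -(@norm_circ s t (ltW s0)) (le_trans _ (lerB_dist _ _)).
Qed.

Lemma continuous_cauchy_kernel k w : `|w| < of_real s ->
  continuous (fun t => phi t * (circ s t - w)^-1 ^+ k).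
Proof.
move=> ws t; apply: cvgM; first exact: cphi.
have cV : (circ s u - w)^-1 @[u --> t] --> (circ s t - w)^-1.
  apply: cvgV; first exact: circ_sub_neq0.
  by apply: cvgB; [exact: continuous_circ|exact: cvg_cst].
exact: cvg_exprn.
Qed.

(** Differentiation under the integral sign: the powers of the kernel
    [(circ s t - w)^-1] have a second order expansion in [w] which is uniform
    in [t]. *)
Lemma is_derive_cauchy_mean k w : `|w| < of_real s ->
  is_derive w 1 (cauchy_mean s k phi) (k%:R * cauchy_mean s k.+1 phi w).
Proof.
move=> ws; apply/is_derive_near => e e0.
have [M M0 HM] := continuous_norm_bound cphi.
pose D := of_real s - `|w|; have D0 : 0 < D by rewrite subr_gt0.
have D2 : 0 < D / 2 by rewrite divr_gt0.
have [B B0 inv_le] : exists2 B : C, 0 <= B &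
    forall x : C, D / 2 <= `|x| -> `|x^-1| <= B.
  exists (D / 2)^-1 => [|x Dx]; first by rewrite invr_ge0 ltW.
  by rewrite normfV lef_pV2 ?posrE//; exact: lt_le_trans Dx.
have [A A0 HA] := expr_taylor k B0.
pose E := A * B ^+ 4 + k%:R * B ^+ k.-1 * B ^+ 3.
have E0 : 0 <= E by rewrite addr_ge0 ?mulr_ge0 ?exprn_ge0 ?ler0n.
have ME : 0 < 2 * (M * E) + 1 by rewrite ltr_wpDl// !mulr_ge0.
have e1 : 0 < e / (2 * (M * E) + 1) by rewrite divr_gt0.
apply: filterS2 (near_dist_le w D2) (near_dist_le w e1) => w'.
rewrite distrC => w'D w'e.
have w's : `|w'| < of_real s.
  rewrite -(subrK w w') (le_lt_trans (ler_normD _ _))// -ltrBrDr.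
  by rewrite (le_lt_trans w'D)// -/D ltr_pdivrMr// ltr_pMr// ltr1n.
pose u t := (circ s t - w)^-1; pose v t := (circ s t - w')^-1.
have u0 t : circ s t - w != 0 by exact: circ_sub_neq0.
have v0 t : circ s t - w' != 0 by exact: circ_sub_neq0.
have uB t : `|u t| <= B.
  apply: inv_le; apply: le_trans (norm_circ_sub t w).
  by rewrite ler_pdivrMr// ler_pMr// ler1n.
have vB t : `|v t| <= B.
  apply: inv_le; apply: le_trans (norm_circ_sub t w').
  rewrite lerBrDr -(subrK w w') (le_trans (lerD (lexx _) (ler_normD _ _)))//.
  rewrite (le_trans (lerD (lexx _) (lerD w'D (lexx _))))//.
  by rewrite addrA -splitr subrK.
have vu t : v t - u t = (w' - w) * (u t * v t).
  by rewrite /u /v; field; rewrite u0 v0.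
pose g t := (- (k%:R * (w' - w))) * (phi t * u t ^+ k.+1)
  + (-1 * (phi t * u t ^+ k) + phi t * v t ^+ k).
have ck := @continuous_cauchy_kernel k _ ws.
have ck1 := @continuous_cauchy_kernel k.+1 _ ws.
have ck' := @continuous_cauchy_kernel k _ w's.
have cg1 : continuous (fun t => -1 * (phi t * u t ^+ k) + phi t * v t ^+ k).
  move=> t; apply: cvgD; last exact: ck'.
  by apply: cvgM; [exact: cvg_cst|exact: ck].
have cg : continuous g.
  move=> t; apply: cvgD; last exact: cg1.
  by apply: cvgM; [exact: cvg_cst|exact: ck1].
rewrite (_ : _ - _ = period_mean g); last first.
  rewrite (period_mean_linear (- (k%:R * (w' - w))) ck1 cg1).
  rewrite (period_mean_linear (-1) ck ck').
  rewrite -[period_mean (fun t => phi t * _ ^+ k.+1)]/(cauchy_mean s k.+1 phi w).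
  rewrite -[X in -1 * X + _]/(cauchy_mean s k phi w).
  rewrite -[X in _ + (_ + X)]/(cauchy_mean s k phi w').
  move: (cauchy_mean s k phi w) (cauchy_mean s k phi w') => a b.
  by move: (cauchy_mean s k.+1 phi w) => c; ring.
apply: le_trans (period_mean_le (M := M * (E * `|w' - w| ^+ 2)) cg _) _; last first.
  rewrite (_ : 2 * _ = `|w' - w| * (2 * (M * E)) * `|w' - w|); last by ring.
  apply: ler_wpM2r => //; move: w'e; rewrite ler_pdivlMr//; apply: le_trans.
  by rewrite ler_wpM2l// lerDl.
move=> t tp.
rewrite (_ : g t = phi t * (v t ^+ k - u t ^+ k - k%:R * u t ^+ k.-1 * (v t - u t)
   + k%:R * u t ^+ k.-1 * ((w' - w) ^+ 2 * (u t ^+ 2 * v t)))); last first.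
  have -> : k%:R * u t ^+ k.-1 * ((w' - w) ^+ 2 * (u t ^+ 2 * v t)) =
     k%:R * u t ^+ k.-1 * ((v t - u t) * (w' - w) * u t) by rewrite vu; ring.
  have -> : (v t - u t) * (w' - w) * u t = (v t - u t) - (w' - w) * u t ^+ 2.
    by rewrite [in RHS]vu mulrBl; ring.
  rewrite /g; case: (k) => [|j] /=; first by rewrite !mul0r; ring.
  by rewrite !exprS; ring.
rewrite normrM ler_pM ?HM// (le_trans (ler_normD _ _))// /E [leRHS]mulrDl lerD//.
  apply: le_trans (HA _ _ (uB t) (vB t)) _; rewrite vu -[leRHS]mulrA ler_wpM2l//.
  rewrite normrM exprMn mulrC ler_wpM2r ?exprn_ge0// normrM exprMn.
  by rewrite (_ : 4 = 2 + 2)%N// exprD ler_pM ?exprn_ge0// lerXn2r ?nnegrE.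
rewrite (_ : _ * `|_| ^+ 2 = k%:R * B ^+ k.-1 * (`|w' - w| ^+ 2 * B ^+ 3)); last by ring.
rewrite normrM ler_pM//.
  by rewrite normrM normr_nat ler_wpM2l ?ler0n// normrX lerXn2r ?nnegrE.
rewrite normrM normrX ler_wpM2l ?exprn_ge0// normrM normrX [B ^+ 3]exprSr.
by rewrite ler_pM ?exprn_ge0// lerXn2r ?nnegrE.
Qed.

End CauchyMean.

Lemma norm_cauchy_mean s (phi : R -> C) w (M : C) : 0 < s -> continuous phi ->
  `|w| < of_real s -> (forall t, 0 <= t <= pi *+ 2 -> `|phi t| <= M) ->
  `|cauchy_mean s 1 phi w| <= 2 * (M / (of_real s - `|w|)).
Proof.
move=> s0 cphi ws HM; have D0 : 0 < of_real s - `|w| by rewrite subr_gt0.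
apply: period_mean_le => [|t tp]; first exact: continuous_cauchy_kernel.
rewrite expr1 normrM ler_pM ?HM// normfV lef_pV2 ?posrE//.
  exact: norm_circ_sub.
by rewrite normr_gt0 circ_sub_neq0.
Qed.

(** The winding number of the circle around [w]: it is constant in [w], as its
    derivative is the integral of a function with a primitive. *)
Lemma cauchy_mean_circ s w : 0 < s -> `|w| < of_real s ->
  cauchy_mean s 1 (circ s) w = 1.
Proof.
move=> s0 ws; have cc := @continuous_circ s.
rewrite (@derive0_constant _ _ (of_real s) _ w ws).
  rewrite /cauchy_mean (_ : (fun t => _) = (fun=> 1)) ?period_mean_cst//.
  apply/funext => t; rewrite subr0 expr1 mulfV// -[circ s t]subr0.
  by rewrite circ_sub_neq0// normr0 of_real_gt0.
move=> z zs; have := is_derive_cauchy_mean s0 cc 1 zs.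
suff -> : cauchy_mean s 2 (circ s) z = 0 by rewrite mulr0.
have dQ t : is_derive (circ s t) 1 (fun v => - (v - z)^-1) ((circ s t - z)^-1 ^+ 2).
  have nz : circ s t - z != 0 by exact: circ_sub_neq0.
  have := is_derive1Z (-1) (is_derive1V (f := fun v => v - z) nz (is_derive1_subr z _)).
  rewrite (_ : (fun v => _) = (fun v => - (v - z)^-1)).
    by rewrite mulN1r mulNr opprK mul1r exprVn.
  by apply/funext => v; rewrite mulN1r.
rewrite -(@period_mean_exact s _ (fun v => (v - z)^-1 ^+ 2) dQ) /cauchy_mean.
by congr period_mean; apply/funext => t; rewrite mulrC.
Qed.

Lemma continuous_on_circ f r s : 0 < s -> s < r ->
  holomorphic_on (disc (of_real r)) f -> continuous (fun t => f (circ s t)).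
Proof.
move=> s0 sr df t; apply: (@continuous_comp _ _ _ (circ s) f).
  exact: continuous_circ.
by apply/differentiable_continuous/df; rewrite /disc /= norm_circ ?ltW// lt_of_real.
Qed.

(** The difference quotient of [f] at [w] is holomorphic, so it has a primitive and
    its integral over the circle vanishes. *)
Lemma cauchy_formula_C2 f r s w : 0 < s -> s < r -> `|w| < of_real s ->
  holomorphic_on (disc (of_real r)) f ->
  holomorphic_on (disc (of_real r)) (derive1 f) ->
  f w = cauchy_mean s 1 (fun t => f (circ s t) * circ s t) w.
Proof.
move=> s0 sr ws df ddf.
have wr : disc (of_real r) w by rewrite /disc /= (lt_trans ws)// lt_of_real.
have sr2 : s < (s + r) / 2 by rewrite midf_lt.
have s2r : (s + r) / 2 < r by rewrite midf_lt.
have [Q HQ] := holomorphic_primitive (lt_trans s0 sr2) s2r (slope_holomorphic wr df ddf).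
have /period_mean_exact : forall t, is_derive (circ s t) 1 Q (slope f w (derive1 f w) (circ s t)).
  by move=> t; apply: HQ; rewrite /disc /= norm_circ ?ltW// lt_of_real.
have cf : continuous (fun t => f (circ s t) * circ s t).
  by move=> t; apply: cvgM; [exact: continuous_on_circ sr df _|exact: continuous_circ].
rewrite (_ : (fun t => _) = (fun t => - f w * (circ s t * (circ s t - w)^-1 ^+ 1) +
    f (circ s t) * circ s t * (circ s t - w)^-1 ^+ 1)).
  rewrite period_mean_linear; [|exact: continuous_cauchy_kernel (@continuous_circ s) _ _ ws|exact: continuous_cauchy_kernel].
  rewrite -/(cauchy_mean s 1 (circ s) w) cauchy_mean_circ// mulr1 => /eqP.
  by rewrite addrC subr_eq0 => /eqP <-.
apply/funext => t; have nz := circ_sub_neq0 s0 t ws.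
have cw : circ s t != w by rewrite -subr_eq0.
by rewrite /slope (negbTE cw) expr1; field.
Qed.

(** A primitive [F] of [f] has the holomorphic derivative [f], so it satisfies
    Cauchy's formula; hence [F] has derivatives of all orders, and so has [f]. *)
Theorem holomorphic_derive1 f r : holomorphic_on (disc (of_real r)) f ->
  holomorphic_on (disc (of_real r)) (derive1 f).
Proof.
move=> df z zr; have zE := of_real_norm z.
have r2 : re `|z| < r by rewrite -lt_of_real zE.
pose s := (re `|z| + r) / 2; pose s' := (s + r) / 2.
have zs : re `|z| < s by rewrite midf_lt.
have sr : s < r by rewrite midf_lt.
have ss' : s < s' by rewrite midf_lt.
have s'r : s' < r by rewrite midf_lt.
have s0 : 0 < s by apply: le_lt_trans zs; rewrite -of_real_ge0 zE.
have [F dF] := holomorphic_primitive (lt_trans s0 ss') s'r df.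
have hF : holomorphic_on (disc (of_real s')) F.
  by move=> v /dF /is_derive_differentiable.
have FE v : disc (of_real s') v -> derive1 F v = f v.
  by move=> /dF /is_derive_derive1.
have hdF : holomorphic_on (disc (of_real s')) (derive1 F).
  move=> v vs; have fv : differentiable f v.
    by apply: df; rewrite /disc /= (lt_trans vs)// lt_of_real.
  have /(near_eq_is_derive _) H := differentiable_is_derive fv.
  apply: is_derive_differentiable; apply: H.
  by apply: filterS (near_disc vs) => u us; rewrite FE.
pose phi t := F (circ s t) * circ s t.
have cphi : continuous phi.
  by move=> t; apply: cvgM; [exact: continuous_on_circ ss' hF _|exact: continuous_circ].
have FC v : disc (of_real s) v -> F v = cauchy_mean s 1 phi v.
  by move=> vs; exact: cauchy_formula_C2 hF hdF.
have fC v : disc (of_real s) v -> f v = cauchy_mean s 2 phi v.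
  move=> vs; have vs' : disc (of_real s') v by rewrite /disc /= (lt_trans vs)// lt_of_real.
  apply: is_derive1_unique (dF v vs') _.
  have := is_derive_cauchy_mean s0 cphi 1 vs; rewrite mul1r.
  apply: near_eq_is_derive.
  by apply: filterS (near_disc vs) => u us; rewrite FC.
have dfC v : disc (of_real s) v -> derive1 f v = 2%:R * cauchy_mean s 3 phi v.
  move=> vs; apply: is_derive_derive1.
  have := is_derive_cauchy_mean s0 cphi 2 vs.
  apply: near_eq_is_derive.
  by apply: filterS (near_disc vs) => u us; rewrite fC.
have zs' : disc (of_real s) z by rewrite /disc /= -zE lt_of_real.
apply: is_derive_differentiable.
apply: near_eq_is_derive (is_derive1Z 2%:R (is_derive_cauchy_mean s0 cphi 3 zs')).
by apply: filterS (near_disc zs') => u us; rewrite dfC.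
Qed.

Theorem cauchy_formula f r s w : 0 < s -> s < r -> `|w| < of_real s ->
  holomorphic_on (disc (of_real r)) f ->
  f w = cauchy_mean s 1 (fun t => f (circ s t) * circ s t) w.
Proof.
by move=> s0 sr ws df; apply: cauchy_formula_C2 (df) (holomorphic_derive1 df).
Qed.

Lemma holomorphic_norm_le f r s w (M : C) : 0 < s -> s < r -> `|w| < of_real s ->
  holomorphic_on (disc (of_real r)) f ->
  (forall t, 0 <= t <= pi *+ 2 -> `|f (circ s t)| <= M) ->
  `|f w| <= 2 * (M * of_real s / (of_real s - `|w|)).
Proof.
move=> s0 sr ws df HM; rewrite (cauchy_formula s0 sr ws df).
apply: norm_cauchy_mean => // t => [|tp].
  by apply: cvgM; [exact: continuous_on_circ sr df _|exact: continuous_circ].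
by rewrite normrM (norm_circ _ (ltW s0)) ler_wpM2r ?HM// of_real_ge0 ltW.
Qed.

(** The quotient is the difference quotient at 0. *)
Lemma holomorphic_divX f r : 0 < r -> holomorphic_on (disc (of_real r)) f ->
  f 0 = 0 -> exists2 g, holomorphic_on (disc (of_real r)) g &
  forall z, f z = z * g z.
Proof.
move=> r0 df f0; exists (slope f 0 (derive1 f 0)).
  by apply: slope_holomorphic; [rewrite /disc /= normr0 of_real_gt0|by []|exact: holomorphic_derive1].
move=> z; rewrite /slope; have [->|z0] := eqVneq z 0; first by rewrite mul0r.
by rewrite f0 !subr0 mulrC divfK.
Qed.

End CircleMean.

(** * Vanishing order at the origin *)

Section VanishingOrder.
Context {R : realType}.
Notation C := (CC R).
Notation holo r := (holomorphic_on (disc (@of_real R r))).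
Implicit Types (f g : C -> C) (r s : R) (z w : C).

Lemma derive1_eq_on f g (a : C) : (forall z, disc a z -> f z = g z) ->
  forall z, disc a z -> derive1 f z = derive1 g z.
Proof.
move=> fg z za; rewrite !derive1E; apply: near_eq_derive.
by apply: filterS (near_disc za) => w /fg.
Qed.

Lemma derive1n_eq_on m f g (a : C) : (forall z, disc a z -> f z = g z) ->
  forall z, disc a z -> derive1n m f z = derive1n m g z.
Proof.
move=> fg; elim: m => [|m IH]; first by rewrite !derive1n0.
by rewrite !derive1nS; exact: derive1_eq_on.
Qed.

Lemma is_derive_exprX n z : is_derive z 1 (fun w : C => w ^+ n.+1) (n.+1%:R * z ^+ n).
Proof.
have := @is_deriveX _ _ id n.+1 z 1 1 (is_derive_id z 1).
by rewrite -[_ *: 1]/(_ * 1) mulr1 exprfctE.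
Qed.

Lemma derive1n_exprX_mul p g r : 0 < r -> holo r g ->
  derive1n p (fun z => z ^+ p * g z) 0 = p`!%:R * g 0.
Proof.
move=> r0; elim: p g => [|p IH] g hg.
  by rewrite derive1n0 expr0 !mul1r.
have zr : disc (of_real r) 0 by rewrite /disc /= normr0 of_real_gt0.
pose G z := p.+1%:R * g z + z * derive1 g z.
have hG : holo r G.
  move=> z zd; have dg := differentiable_is_derive (hg _ zd).
  have ddg := differentiable_is_derive (holomorphic_derive1 hg zd).
  have := is_derive1D (is_derive1Z p.+1%:R dg) (is_derive1M (is_derive_id z 1) ddg).
  exact: is_derive_differentiable.
rewrite derive1Sn (@derive1n_eq_on p _ (fun z => z ^+ p * G z) (of_real r))//.
  by rewrite IH// /G mul0r addr0 mulrA -natrM mulnC -factS.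
move=> z zd; have dg := differentiable_is_derive (hg _ zd).
rewrite (is_derive_derive1 (is_derive1M (is_derive_exprX p z) dg)) /G exprS; ring.
Qed.

(** Dividing by the variable as long as the value at 0 vanishes. *)
Lemma flat_factor N f r : 0 < r -> holo r f ->
  (forall m, (m < N)%N -> derive1n m f 0 = 0) ->
  exists g, [/\ holo r g, forall z, f z = z ^+ N * g z &
                derive1n N f 0 = N`!%:R * g 0].
Proof.
move=> r0 hf; elim: N => [|N IH] H.
  by exists f; split=> // [z|]; rewrite ?derive1n0 ?expr0 ?mul1r.
have [m mN|g [hg fE dE]] := IH; first by apply: H; rewrite ltnS ltnW.
have g0 : g 0 = 0.
  apply/eqP; move: (H N (ltnSn N)) => /eqP; rewrite dE mulf_eq0 pnatr_eq0.
  by rewrite gtn_eqF ?fact_gt0.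
have [h hh gE] := holomorphic_divX r0 hg g0.
have fE' z : f z = z ^+ N.+1 * h z by rewrite fE gE exprSr mulrA.
exists h; split=> //.
rewrite -(derive1n_exprX_mul N.+1 r0 hh).
by rewrite (funext fE').
Qed.

Lemma geometric_le0 (a q c : R) : 0 <= q < 1 -> 0 <= c ->
  (forall N, a <= q ^+ N * c) -> a <= 0.
Proof.
move=> /andP[q0 q1] c0 H; apply/ler_addgt0Pr => e e0; rewrite add0r.
have q1' : `|q| < 1 by rewrite ger0_norm.
have c1 : 0 < e / (c + 1) by rewrite divr_gt0// ltr_wpDl.
have /cvgr0Pnorm_le/(_ _ c1)[N _ HN] := cvg_expr q1'.
apply: le_trans (H N) _; have := HN N (leqnn N).
rewrite /= ger0_norm ?exprn_ge0// ler_pdivlMr ?ltr_wpDl//; apply: le_trans.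
by rewrite ler_wpM2l ?exprn_ge0// lerDl.
Qed.

(** All the quotients of [f] by powers of the variable are holomorphic, and Cauchy's
    formula on a circle of radius [s] bounds the quotient by [z ^+ N] by a constant
    times [s ^- N]; so [`|f w|] is at most a constant times [(`|w| / s) ^+ N]. *)
Lemma identity_theorem f r : holo r f -> (forall m, derive1n m f 0 = 0) ->
  forall z, disc (of_real r) z -> f z = 0.
Proof.
move=> hf H w wr; have wE := of_real_norm w.
have r2 : re `|w| < r by rewrite -lt_of_real wE.
have [s ws sr] : exists2 s, re `|w| < s & s < r.
  by exists ((re `|w| + r) / 2); rewrite midf_lt.
have w0 : 0 <= re `|w| by rewrite -of_real_ge0 wE.
have s0 : 0 < s by apply: le_lt_trans ws.
have [M M0 HM] := continuous_norm_bound (continuous_on_circ s0 sr hf).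
have MR : M = of_real (re M) by exact: ge0_of_real.
have M0' : 0 <= re M by rewrite -of_real_ge0 -MR.
have D0 : 0 < s - re `|w| by rewrite subr_gt0.
apply/eqP; rewrite -normr_le0 -of_real_norm -[0]/(of_real 0) le_of_real.
apply: (@geometric_le0 _ (re `|w| / s) (2 * (re M * s / (s - re `|w|)))).
- by rewrite divr_ge0 ?(ltW s0)//= ltr_pdivrMr// mul1r.
- by rewrite mulr_ge0// divr_ge0 ?(ltW D0)// mulr_ge0// ltW.
move=> N; have [g [hg fE _]] := flat_factor (lt_trans s0 sr) hf (fun m (_ : (m < N)%N) => H m).
have sN : 0 < of_real s ^+ N by rewrite exprn_gt0// of_real_gt0.
have gM t : 0 <= t <= pi *+ 2 -> `|g (circ s t)| <= of_real (re M / s ^+ N).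
  move=> tp; rewrite of_realM fmorphV rmorphXn /= -MR ler_pdivlMr// mulrC.
  by have := HM t tp; rewrite fE normrM normrX norm_circ// ltW.
have wl : `|w| < of_real s by rewrite -wE lt_of_real.
have := holomorphic_norm_le s0 sr wl hg gM.
rewrite -le_of_real of_real_norm fE normrM normrX => Hg.
apply: le_trans (ler_wpM2l _ Hg) _; first by rewrite exprn_ge0.
rewrite -{1 2}wE -of_realB -of_realM -fmorphV -of_realM -(rmorph_nat (@of_real R)).
rewrite -of_realM -rmorphXn -of_realM le_of_real le_eqVlt; apply/orP; left; apply/eqP.
rewrite expr_div_n; move: (re `|w|) (re M) D0 => x m D0.
have sN0 : s ^+ N != 0 by rewrite expf_neq0// gt_eqF.
by move: (s ^+ N) sN0 => y y0; field; rewrite y0 gt_eqF.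
Qed.

(** The derivative of [f] is divisible by the [l]-th power of the variable. *)
Lemma flat_lipschitz l f r : 0 < r -> holo r f ->
  (forall m, (m <= l)%N -> derive1n m f 0 = 0) ->
  exists M d : C, [/\ 0 <= M, 0 < d & forall a b, `|a| < d -> `|b| < d ->
    `|f a - f b| <= M * (`|a| + `|b|) ^+ l * `|a - b|].
Proof.
move=> r0 hf H.
have [|g [hg dfE _]] := @flat_factor l (derive1 f) r r0 (holomorphic_derive1 hf).
  by move=> m ml; rewrite -derive1Sn H.
have zr : disc (of_real r) 0 by rewrite /disc /= normr0 of_real_gt0.
have cg := differentiable_continuous (hg _ zr).
have := cg; move=> /(@cvgrPdist_le _ _ _ (nbhs 0))/(_ _ ltr01) Hg.
have /nbhs_normP[d /= d0 Hd] : \forall z \near (0 : C),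
    `|g 0 - g z| <= 1 /\ disc (of_real r) z.
  by apply: filterS2 Hg (near_disc zr) => z.
exists (2 * (`|g 0| + 1)), (d / 2); split=> [||a b ad bd].
- by rewrite mulr_ge0// addr_ge0.
- by rewrite divr_gt0.
have seg t : 0 <= t <= 1 -> `|segment b a t| <= `|a| + `|b|.
  move=> /andP[t0 t1]; have -> : segment b a t = of_real t * a + of_real (1 - t) * b.
    by rewrite /segment of_realB rmorph1; ring.
  rewrite (le_trans (ler_normD _ _))// !normrM !norm_of_real lerD// ler_piMl//.
    by rewrite ger0_norm// -[leRHS]/(of_real 1) le_of_real.
  by rewrite ger0_norm ?subr_ge0// -[leRHS]/(of_real 1) le_of_real gerBl.
have segd t : 0 <= t <= 1 -> ball_ Num.Def.normr 0 d (segment b a t).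
  move=> t01; rewrite /ball_ /= sub0r normrN (le_lt_trans (seg t t01))//.
  by rewrite [d]splitr ltrD.
rewrite -[2 * _ * _]mulrA.
apply: (@segment_mean_value _ f (fun t => derive1 f (segment b a t))) => t t01.
  by have [_ sd] := Hd _ (segd t t01); exact/differentiable_is_derive/hf.
have [gs _] := Hd _ (segd t t01).
rewrite dfE normrM mulrC normrX ler_pM ?exprn_ge0//.
  by rewrite -(subrK (g 0) (g _)) (le_trans (ler_normD _ _))// addrC lerD// distrC.
by rewrite lerXn2r ?nnegrE ?addr_ge0// seg.
Qed.

Lemma ord_gt_flat l f : (l%:R%:E < ord R f)%E ->
  forall m, (m <= l)%N -> derive1n m f 0 = 0.
Proof.
move=> lf m ml; apply: contrapT => /eqP fm; move: lf; rewrite ltNge => /negP; apply.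
apply: (@le_trans _ _ m%:R%:E); last by rewrite lee_fin ler_nat.
by apply: ereal_inf_lbound; exists m.
Qed.

End VanishingOrder.

(** * The contact of two branches *)

Section RowVectorLimits.
Variables (K : numFieldType) (n : nat) (T : Type) (F : set_system T).
Context {FF : Filter F}.

Lemma cvg_rV (f : T -> 'rV[K]_n) (v : 'rV[K]_n) :
  (forall j, f t 0 j @[t --> F] --> v 0 j) -> f @ F --> v.
Proof.
move=> fv; pose S s (u : 'rV[K]_n) : 'rV[K]_n := \sum_(j <- s) u 0 j *: delta_mx 0 j.
have SE u : S (index_enum 'I_n) u = u by rewrite [RHS]row_sum_delta.
have cS s : S s (f t) @[t --> F] --> S s v.
  elim: s => [|j s IH].
    have -> : (fun t => S [::] (f t)) = cst 0 by apply/funext => t; rewrite /S big_nil.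
    by rewrite /S big_nil; exact: cvg_cst.
  have -> : (fun t => S (j :: s) (f t)) =
      (fun t => f t 0 j *: delta_mx 0 j + S s (f t)).
    by apply/funext => t; rewrite /S big_cons.
  rewrite {2}/S big_cons; apply: cvgD; last exact: IH.
  exact: cvgZr_tmp.
have := cS (index_enum 'I_n); rewrite SE.
by have -> : (fun t => S (index_enum 'I_n) (f t)) = f by apply/funext => t; exact: SE.
Qed.

Lemma cvg_rV_coord (f : T -> 'rV[K]_n) (v : 'rV[K]_n) j :
  f @ F --> v -> f t 0 j @[t --> F] --> v 0 j.
Proof.
move=> fv; apply: (@cvg_comp _ _ _ f (fun M : 'rV[K]_n => M 0 j) _ _ _ fv).
exact: coord_continuous.
Qed.

End RowVectorLimits.

Section Contact.
Context {R : realType} {n : nat}.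
Notation C := (CC R).
Notation holo r := (holomorphic_on (disc (@of_real R r))).

(** A branch through the origin with tangent line spanned by the first basis
    vector, of multiplicity [k], in Puiseux form. *)
Definition branch (k : nat) (r : R) (Phi : C -> 'rV[C]_n.+1) :=
  [/\ holo r Phi, Phi 0 = 0,
      forall t, disc (of_real r) t -> Phi t 0 0 = t ^+ k &
      forall i : 'I_n.+1, i != 0 -> (k%:R%:E < ord R (fun t : C => Phi t 0%R i))%E].

Lemma coord_holomorphic (r : C) (Phi : C -> 'rV[C]_n.+1) i :
  holomorphic_on (disc r) Phi -> holomorphic_on (disc r) (fun t => Phi t 0 i).
Proof.
move=> dPhi t tr; apply: (@differentiable_comp _ _ _ _ Phi (fun M : 'rV[C]_n.+1 => M 0 i)).
  exact: dPhi.
exact: differentiable_coord.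
Qed.

Lemma branch_lipschitz k r Phi (i : 'I_n.+1) : 0 < r -> branch k r Phi -> i != 0 ->
  exists M d : C, [/\ 0 <= M, 0 < d & forall a b, `|a| < d -> `|b| < d ->
    `|Phi a 0 i - Phi b 0 i| <= M * (`|a| + `|b|) ^+ k * `|a - b|].
Proof.
move=> r0 [hPhi _ _ ordPhi] i0; apply: (@flat_lipschitz _ k (fun t => Phi t 0 i) r) => //.
  exact: coord_holomorphic.
by apply: ord_gt_flat; exact: ordPhi.
Qed.

Lemma branch_le k r Phi (i : 'I_n.+1) : 0 < r -> branch k r Phi -> i != 0 ->
  exists M d : C, [/\ 0 <= M, 0 < d &
    forall a, `|a| < d -> `|Phi a 0 i| <= M * `|a| ^+ k.+1].
Proof.
move=> r0 br i0; have [M [d [M0 d0 H]]] := branch_lipschitz r0 br i0.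
case: br => _ Phi0 _ _; exists M, d; split=> // a ad.
have := H a 0 ad; rewrite normr0 Phi0 mxE !subr0 addr0 exprSr mulrA; exact.
Qed.

Section Gap.
Variables (k l : nat) (r : R) (Phi Psi : C -> 'rV[C]_n.+1) (e : C).
Hypotheses (r_gt0 : 0 < r) (l_gt0 : (0 < l)%N) (k_gt0 : (0 < k)%N).
Hypotheses (bPhi : branch k r Phi) (bPsi : branch l r Psi) (el : e ^+ l = 1).

Let D := [set t : C | disc (of_real r) (t ^+ l) /\ disc (of_real r) (e * t ^+ k)].
Let gapc j (t : C) := gap k l Phi Psi e t 0 j.

Lemma norm_unity_root : `|e| = 1.
Proof.
apply/eqP; rewrite -(@pexpr_eq1 _ _ l)// -?normrX ?el ?normr1//.
Qed.

Let gapcE j t : gapc j t = Phi (t ^+ l) 0 j - Psi (e * t ^+ k) 0 j.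
Proof. by rewrite /gapc /gap !mxE. Qed.

Let disc_in_D (a : R) : 0 < a -> a ^+ l <= r -> a ^+ k <= r -> disc (of_real a) `<=` D.
Proof.
move=> a0 al ak t; rewrite /disc /= => ta.
have ple (m : nat) : (0 < m)%N -> a ^+ m <= r -> `|t ^+ m| < of_real r.
  move=> m0 am; rewrite normrX; apply: (@lt_le_trans _ _ (of_real (a ^+ m))).
    by rewrite rmorphXn /= ltr_pXn2r ?nnegrE// of_real_ge0 ltW.
  by rewrite le_of_real.
split; first exact: ple.
by rewrite /disc /= normrM norm_unity_root mul1r; exact: ple.
Qed.

Let gapc_holo j (a : R) : disc (of_real a) `<=` D -> holo a (gapc j).
Proof.
have [hPhi _ _ _] := bPhi; have [hPsi _ _ _] := bPsi.
move=> aD t /aD [tl tk].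
have -> : gapc j = (fun t => Phi (t ^+ l) 0 j - Psi (e * t ^+ k) 0 j).
  exact/funext/gapcE.
have dX (m : nat) : differentiable (fun t : C => t ^+ m) t.
  by apply/derivable1_diffP; exact: exprn_derivable.
have dek : differentiable (fun t : C => e * t ^+ k) t.
  exact: is_derive_differentiable (is_derive1Z e (differentiable_is_derive (dX k))).
have d1 := @differentiable_comp _ _ _ _ (fun t : C => t ^+ l) (fun s => Phi s 0 j) t
  (dX l) (coord_holomorphic j hPhi tl).
have d2 := @differentiable_comp _ _ _ _ (fun t : C => e * t ^+ k) (fun s => Psi s 0 j) t
  dek (coord_holomorphic j hPsi tk).
exact: differentiableB d1 d2.
Qed.

Let D_disc t : D t -> exists a : R, [/\ `|t| < of_real a, 0 < a & disc (of_real a) `<=` D].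
Proof.
move=> [tl tk]; set x := re `|t|; have xE : of_real x = `|t| by exact: of_real_norm.
have x0 : 0 <= x by rewrite -of_real_ge0 xE.
have lt_r (m : nat) : disc (of_real r) (t ^+ m) -> \forall y \near x, y ^+ m <= r.
  rewrite /disc /= normrX -xE -rmorphXn lt_of_real => xr.
  have rx : 0 < r - x ^+ m by rewrite subr_gt0.
  have := @exprn_continuous _ m x; move=> /cvgrPdist_le/(_ _ rx).
  apply: filterS => y; rewrite distrC => /(le_trans (ler_norm _)).
  by rewrite lerD2r.
have tk' : disc (of_real r) (t ^+ k).
  by move: tk; rewrite /disc /= normrM norm_unity_root mul1r.
have /nbhs_normP[d /= d0 Hd] : \forall y \near x, y ^+ l <= r /\ y ^+ k <= r.
  by apply: filterS2 (lt_r _ tl) (lt_r _ tk') => y.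
have [|al ak] := Hd (x + d / 2).
  rewrite /ball_ /= opprD addrA subrr sub0r normrN gtr0_norm ?divr_gt0//.
  by rewrite ltr_pdivrMr// ltr_pMr// ltr1n.
have a0 : 0 < x + d / 2 by rewrite ltr_wpDl// divr_gt0.
exists (x + d / 2); split; [|exact: a0|exact: disc_in_D].
by rewrite -xE lt_of_real ltrDl divr_gt0.
Qed.

Let D0 : D 0.
Proof.
by rewrite /D /disc /= !expr0n !gtn_eqF// mulr0 normr0 of_real_gt0.
Qed.

Let gap_flat j : exists M d : C, [/\ 0 <= M, 0 < d &
  forall t, `|t| < d -> `|gapc j t| <= M * `|t| ^+ (k * l).+1].
Proof.
have [-> |j0] := eqVneq j 0.
  have [a [_ a0 aD]] := D_disc D0.
  exists 0, (of_real a); split=> // [|t /aD[tl tk]]; first by rewrite of_real_gt0.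
  have [_ _ fPhi _] := bPhi; have [_ _ fPsi _] := bPsi.
  rewrite gapcE fPhi// fPsi// exprMn el mul1r -!exprM mulnC subrr normr0.
  by rewrite mul0r.
have [M1 [d1 [M10 d10 H1]]] := branch_le r_gt0 bPhi j0.
have [M2 [d2 [M20 d20 H2]]] := branch_le r_gt0 bPsi j0.
have pos (x y : C) : 0 < x -> 0 < y -> exists z : C, [/\ 0 < z, z <= x & z <= y].
  move=> x0 y0; have xy : 0 < x + y by rewrite addr_gt0.
  exists (x * y / (x + y)); split; first by rewrite divr_gt0 ?mulr_gt0.
    by rewrite ler_pdivrMr// mulrDr lerDr mulr_ge0// ltW.
  by rewrite ler_pdivrMr// mulrDr [y * x]mulrC lerDl mulr_ge0// ltW.
have [d3 [d30 d31 d32]] := pos _ _ d10 d20.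
have [d [dpos dd3 dd1]] := pos _ _ d30 ltr01.
exists (M1 + M2), d; split=> // [|t td]; first by rewrite addr_ge0.
have t1 : `|t| <= 1 by rewrite ltW// (lt_le_trans td).
have pw m : (0 < m)%N -> `|t ^+ m| < d3.
  move=> m0; rewrite normrX (lt_le_trans _ dd3)// (le_lt_trans _ td)//.
  by rewrite ler_iXnr.
rewrite gapcE (le_trans (ler_normB _ _))// mulrDl lerD//.
  apply: le_trans (H1 _ _) _; first by rewrite (lt_le_trans (pw _ l_gt0)).
  rewrite ler_wpM2l// normrX -exprM ler_wiXn2l// mulnS mulnC.
  by rewrite -[X in (X <= _)%N]add1n leq_add2r.
apply: le_trans (H2 _ _) _; rewrite normrM norm_unity_root mul1r.
  by rewrite (lt_le_trans (pw _ k_gt0)).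
rewrite ler_wpM2l// normrX -exprM ler_wiXn2l// mulnS.
by rewrite -[X in (X <= _)%N]add1n leq_add2r.
Qed.

(** The contact order counts the common factors of the variable in all the
    coordinates of the gap, and the contact direction is the value at 0 of the
    quotient. *)
Lemma contact_direction_spec (v := contact_direction R k l (of_real r) Phi Psi e) :
  (v = 0 /\ \forall t \near 0, gap k l Phi Psi e t = 0) \/
  exists N G, [/\ v != 0, (k * l < N)%N,
    forall t : C, gap k l Phi Psi e t = t ^+ N *: G t &
    G t @[t --> 0] --> v].
Proof.
have [a [_ a0 aD]] := D_disc D0.
have za : disc (of_real a) 0 by rewrite /disc /= normr0 of_real_gt0.
have [g0|ng0] := pselect (gap_eq0 k l (of_real r) Phi Psi e).
  left; have gap0 : \forall t \near (0 : C), gap k l Phi Psi e t = 0.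
    by apply: filterS (near_disc za) => t /aD[]; exact: g0.
  split=> //; rewrite /v /contact_direction /contact_order asboolT//.
  apply: cvg_lim => //; apply: cvg_near_cst.
  apply: (@cvg_within _ (nbhs (0 : C))); apply: filterS gap0 => t ->.
  by rewrite scaler0.
right.
pose P m := [exists j : 'I_n.+1, derive1n m (gapc j) 0 != 0].
have exP : exists m, P m.
  apply: contrapT => nP; apply: ng0 => t tl tk; have [b [tb b0 bD]] := D_disc (conj tl tk).
  apply/rowP => j; rewrite [RHS]mxE.
  apply: (@identity_theorem _ (gapc j) b (gapc_holo j bD)) => // m.
  apply: contrapT => /eqP dm; apply: nP; exists m; apply/existsP; by exists j.
have [N /existsP[j0 j0N] Nmin] := ex_minnP exP.
have flatN j m : (m < N)%N -> derive1n m (gapc j) 0 = 0.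
  move=> mN; apply/eqP; apply: contraTT mN => dm; rewrite -leqNgt; apply: Nmin.
  by apply/existsP; exists j.
have /choice[g Hg] j := flat_factor a0 (gapc_holo j aD) (flatN j).
pose G t : 'rV[C]_n.+1 := \row_j g j t.
have GE t : gap k l Phi Psi e t = t ^+ N *: G t.
  by apply/rowP => j; rewrite [RHS]mxE [in RHS]mxE; have [_ + _] := Hg j; exact.
have cG : G t @[t --> (0 : C)] --> G 0.
  apply: (@cvg_rV _ _ _ (nbhs (0 : C))) => j; rewrite mxE.
  have -> : (fun t => G t 0 j) = g j by apply/funext => t; rewrite mxE.
  by apply/differentiable_continuous; have [hg _ _] := Hg j; exact: hg.
have G0 : G 0 != 0.
  apply/eqP => /rowP/(_ j0); rewrite !mxE => gj0.
  by have [_ _] := Hg j0; rewrite gj0 mulr0; apply/eqP.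
have NE : contact_order R k l (of_real r) Phi Psi e = N.
  rewrite /contact_order asboolF//.
  suff -> : ord_map R (gap k l Phi Psi e) = N%:R%:E by rewrite /= natrK.
  apply/eqP; rewrite eq_le; apply/andP; split.
    apply: le_trans (bigmin_le _ j0 _) _; apply: ereal_inf_lbound.
    by exists N.
  apply: le_bigmin; first by rewrite leey.
  move=> j _; apply: le_ereal_inf_tmp => _ [m dm <-]; rewrite lee_fin ler_nat.
  by apply: Nmin; apply/existsP; exists j.
have vE : v = G 0.
  rewrite /v /contact_direction NE; apply: cvg_lim => //.
  have cG' : G t @[t --> (0 : C)^'] --> G 0 by exact: cvg_within_filter cG.
  apply: (cvg_trans _ cG').
  apply: near_eq_cvg; rewrite near_withinE; apply: nearW => t t0.
  by rewrite GE scalerA mulVf ?scale1r// expf_neq0.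
exists N, G; rewrite vE; split=> //.
(* Otherwise the gap, which is [O(t ^ (k * l).+1)], is divisible by a higher power. *)
rewrite ltnNge; apply/negP => Nkl.
have [M [d [M0 d0 HM]]] := gap_flat j0.
have g0 : g j0 0 = 0.
  have Hgj t : gapc j0 t = t ^+ N * g j0 t by have [_ + _] := Hg j0; exact.
  have cgj : {for 0, continuous (g j0)}.
    by apply/differentiable_continuous; have [hg _ _] := Hg j0; exact: hg.
  have c2 : g j0 t @[t --> (0 : C)^'] --> g j0 0 by exact: cvg_within_filter cgj.
  apply: (cvg_unique _ c2); first exact: norm_hausdorff.
  apply/cvgr0Pnorm_le => eps eps0; rewrite near_withinE.
  have M1 : 0 < M + 1 by rewrite ltr_wpDl.
  have e1 : 0 < eps / (M + 1) by rewrite divr_gt0.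
  have d2 : 0 < d / 2 by rewrite divr_gt0.
  apply: filterS3 (near_dist_le (0 : C) d2) (near_dist_le (0 : C) e1)
    (near_dist_le (0 : C) ltr01) => t.
  rewrite sub0r normrN => td te t1 t0.
  have tN : 0 < `|t| ^+ N by rewrite exprn_gt0// normr_gt0.
  have td' : `|t| < d by rewrite (le_lt_trans td)// ltr_pdivrMr// ltr_pMr// ltr1n.
  rewrite -(ler_pM2l tN) -normrX -normrM -Hgj (le_trans (HM t td'))// normrX.
  apply: (@le_trans _ _ (M * `|t| ^+ N.+1)); first by rewrite ler_wpM2l// ler_wiXn2l.
  rewrite exprSr mulrCA ler_wpM2l ?exprn_ge0//; move: te.
  rewrite ler_pdivlMr// mulrC; apply: le_trans.
  by rewrite ler_wpM2r// lerDl.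
by have [_ _] := Hg j0; rewrite g0 mulr0; apply/eqP.
Qed.

End Gap.
End Contact.

(** * Roots of unity, limits and spans *)

Section RootsOfUnity.
Variable K : numClosedFieldType.

Lemma unity_roots l : (0 < l)%N -> exists rs : seq K,
  [/\ uniq rs, size rs = l, forall x, x \in rs = (x ^+ l == 1) &
      forall a b : K, a ^+ l - b ^+ l = \prod_(x <- rs) (a - x * b)].
Proof.
move=> l0; have [rs E] := closed_field_poly_normal ('X^l - 1 : {poly K}).
have lc : lead_coef ('X^l - 1 : {poly K}) = 1 by apply/eqP; exact: monic_Xn_sub_1.
rewrite lc scale1r in E.
have srs : size rs = l.
  by apply/eqP; rewrite -eqSS -(size_Xn_sub_1 K l0) E size_prod_XsubC.
exists rs; split=> //.
- by rewrite -separable_prod_XsubC -E; apply: separable_Xn_sub_1; rewrite pnatr_eq0 -lt0n.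
- move=> x; rewrite -root_prod_XsubC -E /root !hornerE.
  by rewrite ?hornerXn subr_eq0.
move=> a b; have [->|b0] := eqVneq b 0.
  rewrite expr0n gtn_eqF// subr0 (eq_bigr (fun=> a)); last by move=> x _; rewrite mulr0 subr0.
  by rewrite big_const_seq count_predT srs iter_mulr_1.
rewrite (eq_bigr (fun x => b * (a / b - x))); last first.
  by move=> x _; field.
rewrite big_split /= big_const_seq count_predT srs iter_mulr_1.
have := congr1 (horner ^~ (a / b)) E; rewrite horner_prod !hornerE ?hornerXn.
rewrite (eq_bigr (fun x => a / b - x)); last by move=> x _; rewrite !hornerE.
by move=> <-; rewrite mulrBr mulr1 -exprMn mulrC divfK.
Qed.

(** Suppose that among the multiples of [b] by roots of unity, [b] itself is nearest
    to [a]. Then [`|a - x * b|] is at least half the distance between [b] and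
    [x * b], so the factors of [a ^+ l - b ^+ l] other than [a - b] are bounded
    below by a constant times [`|a| + `|b|]. *)
Lemma nearest_root_lower_bound l : (0 < l)%N -> exists2 c : K, 0 < c &
  forall a b : K, (forall x, x ^+ l = 1 -> `|a - b| <= `|a - x * b|) ->
    c * (`|a| + `|b|) ^+ l.-1 * `|a - b| <= `|a ^+ l - b ^+ l|.
Proof.
move=> l0; have [rs [urs srs rsE prodE]] := unity_roots l0.
have r1 : 1 \in rs by rewrite rsE expr1n eqxx.
have others s : 1 \notin s -> exists2 c : K, 0 < c & forall a b : K,
    (forall x, x \in s -> `|a - b| <= `|a - x * b|) ->
    c * (`|a| + `|b|) ^+ size s <= \prod_(x <- s) `|a - x * b|.
  elim: s => [_|y s IH]; first by exists 1 => // a b _; rewrite expr0 big_nil mulr1.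
  rewrite inE negb_or => /andP[y1 /IH[c c0 H]].
  have y10 : 0 < `|y - 1| by rewrite normr_gt0 subr_eq0 eq_sym.
  pose q := 1 + 4 / `|y - 1|.
  have q0 : 0 < q by rewrite addr_gt0// divr_gt0.
  exists (q^-1 * c) => [|a b Hab]; first by rewrite mulr_gt0// invr_gt0.
  rewrite big_cons exprS mulrACA ler_pM ?mulr_ge0 ?invr_ge0 ?exprn_ge0 ?addr_ge0 ?(ltW q0) ?(ltW c0)//; last first.
    by apply: H => x xs; apply: Hab; rewrite inE xs orbT.
  rewrite ler_pdivrMl//.
  have yb := Hab y (mem_head _ _).
  have bb : `|y - 1| * `|b| <= 2 * `|a - y * b|.
    rewrite -normrM (_ : (y - 1) * b = (a - b) - (a - y * b)); last by ring.
    by rewrite (le_trans (ler_normB _ _))// mulr2n mulrDl mul1r lerD2r.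
  have bb' : `|b| <= 2 / `|y - 1| * `|a - y * b|.
    by rewrite mulrAC ler_pdivlMr// mulrC.
  have aa : `|a| <= `|a - y * b| + `|b|.
    rewrite -{1}(subrK b a) (le_trans (ler_normD _ _))// lerD2r//.
  rewrite (le_trans (lerD aa (lexx _)))// -addrA /q mulrDl mul1r lerD2l.
  apply: le_trans (lerD bb' bb') _.
  by rewrite le_eqVlt; apply/orP; left; apply/eqP; field; rewrite gt_eqF.
have [|c c0 H] := others (rem 1 rs); first by rewrite mem_rem_uniqF.
exists c => // a b Hab; rewrite prodE normr_prod (big_rem 1 r1) /= mul1r mulrC.
rewrite ler_wpM2l//; move: (H a b); rewrite size_rem// srs; apply=> x xr.
by apply: Hab; apply/eqP; rewrite -rsE (mem_rem xr).
Qed.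

End RootsOfUnity.

Section FilterLimits.
Variables (K : numFieldType) (T : Type) (F : set_system T).
Context {FF : Filter F}.

Lemma cvg0_le (V W : normedModType K) (f : T -> V) (g : T -> W) (A : K) :
  0 <= A -> (\forall t \near F, `|f t| <= A * `|g t|) -> g @ F --> 0 -> f @ F --> 0.
Proof.
move=> A0 fg g0; apply/cvgr0Pnorm_le => e e0.
have A1 : 0 < A + 1 by rewrite ltr_wpDl.
have e1 : 0 < e / (A + 1) by rewrite divr_gt0.
have /cvgr0Pnorm_le/(_ _ e1) := g0; apply: filterS2 fg => t fgt.
rewrite ler_pdivlMr// mulrC; apply: le_trans; apply: le_trans fgt _.
by rewrite ler_wpM2r// lerDl.
Qed.

Lemma cvg0_expr (f : T -> K) n : (0 < n)%N ->
  f t ^+ n @[t --> F] --> (0 : K) -> f @ F --> (0 : K).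
Proof.
move=> n0 H; apply/cvgr0Pnorm_lt => e e0.
have en : 0 < e ^+ n by rewrite exprn_gt0.
have /cvgr0Pnorm_lt/(_ _ en) := H; apply: filterS => t.
by rewrite normrX ltr_pXn2r// ?nnegrE// ltW.
Qed.

End FilterLimits.

Lemma LinP (K : numClosedFieldType) n (v w u : 'rV[K]_n) :
  Lin v w u <-> exists a b, u = a *: v + b *: w.
Proof.
rewrite /Lin /=; split.
  rewrite span_cons span_seq1 => /memv_addP[x /vlineP[a ->] [y /vlineP[b ->] ->]].
  by exists a, b.
move=> [a [b ->]]; rewrite span_cons span_seq1.
by apply: memv_add; apply/vlineP; [exists a|exists b].
Qed.

Section Cone.
Context {R : realType} {n : nat}.
Notation C := (CC R).
Notation e1 := (delta_mx 0 0 : 'rV[C]_n.+1).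

(** Sequences are obtained by letting the parameter run through a sequence of
    nonzero numbers tending to 0. *)
Lemma cone_of_param (X Y : set 'rV[C]_n.+1) (x y : C -> 'rV[C]_n.+1) (la : C -> C) (v : 'rV[C]_n.+1) :
  (\forall t \near (0 : C)^', X (x t) /\ Y (y t)) ->
  x @ (0 : C)^' --> (0 : 'rV[C]_n.+1) -> y @ (0 : C)^' --> (0 : 'rV[C]_n.+1) ->
  la t *: (y t - x t) @[t --> (0 : C)^'] --> v ->
  relative_tangent_cone X Y v.
Proof.
rewrite near_withinE => /nbhs_normP[d /= d0 Hd] x0 y0 lv.
have dE := ge0_of_real (ltW d0).
have d1 : 0 < re d by rewrite -of_real_gt0 -dE.
pose t j : C := of_real (re d / 2 * harmonic j).
have t_neq0 j : t j != 0 by rewrite of_real_eq0 gt_eqF// mulr_gt0 ?divr_gt0 ?invr_gt0.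
have td j : `|t j| < d.
  rewrite norm_of_real [ltRHS]dE lt_of_real gtr0_norm ?mulr_gt0 ?divr_gt0 ?invr_gt0//.
  by rewrite ltr_pdivrMr// ltr_pdivrMr// -mulrA ltr_pMr// -natrM ltr1n mulSn.
have tc : t @ \oo --> (0 : C).
  rewrite -[0 : C]/(of_real 0) -[0 : R](mulr0 (re d / 2)).
  apply: (@cvg_comp _ _ _ (fun j => re d / 2 * harmonic j) (@of_real R) _ (nbhs (re d / 2 * 0))).
    exact: cvgMr cvg_harmonic.
  exact: continuous_of_real.
have t0 : t @ \oo --> (0 : C)^'.
  move=> P /tc H; have {}H : \forall j \near \oo, t j != 0 -> P (t j) by exact: H.
  rewrite /nbhs /= /fmap; apply: filterS H => j Pj; exact: Pj (t_neq0 j).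
exists (x \o t), (y \o t), (la \o t); split.
- by split=> j; have [] := Hd (t j) _ (t_neq0 j); rewrite //= sub0r normrN.
- exact: cvg_comp t0 x0.
- exact: cvg_comp t0 y0.
- exact: (cvg_comp _ _ t0 lv).
Qed.

End Cone.

(** * From the spans to the cone *)

Lemma cvg_geometric_sum (K : numFieldType) (T : Type) (F : set_system T)
    {FF : Filter F} (f : T -> K) n :
  f @ F --> (1 : K) -> \sum_(i < n) f t ^+ i @[t --> F] --> (n%:R : K).
Proof.
move=> f1; elim: n => [|n IH].
  have -> : (fun t => \sum_(i < 0) f t ^+ i) = cst 0.
    by apply/funext => t; rewrite big_ord0.
  exact: cvg_cst.
have -> : (fun t => \sum_(i < n.+1) f t ^+ i) =
    (fun t => \sum_(i < n) f t ^+ i + f t ^+ n).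
  by apply/funext => t; rewrite big_ord_recr.
rewrite -natr1; apply: cvgD; first exact: IH.
by rewrite -(expr1n K n); exact: cvg_exprn.
Qed.

Section TwoBranches.
Context {R : realType} {n : nat}.
Notation C := (CC R).
Notation e1 := (delta_mx 0 0 : 'rV[C]_n.+1).
Variables (X Y : set 'rV[C]_n.+1) (k l : nat) (r : R) (Phi Psi : C -> 'rV[C]_n.+1).
Hypotheses (r_gt0 : 0 < r) (l_gt0 : (0 < l)%N) (k_gt0 : (0 < k)%N).
Hypotheses (bPhi : branch k r Phi) (bPsi : branch l r Psi).

Lemma branch_cvg (m : nat) (Th : C -> 'rV[C]_n.+1) (T : Type) (F : set_system T)
    {FF : Filter F} (h : T -> C) :
  branch m r Th -> h @ F --> (0 : C) -> Th (h t) @[t --> F] --> (0 : 'rV[C]_n.+1).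
Proof.
move=> [dTh Th0 _ _] h0.
have cT : {for 0, continuous Th}.
  by apply/differentiable_continuous/dTh; rewrite /disc /= normr0 of_real_gt0.
have {}cT : Th @ (0 : C) --> (0 : 'rV[C]_n.+1) by rewrite -[X in _ --> X]Th0.
exact: cvg_comp h0 cT.
Qed.

Section SpansInCone.
Hypotheses (XPhi : forall t, disc (of_real r) t -> X (Phi t))
           (YPsi : forall t, disc (of_real r) t -> Y (Psi t)).

Let disc0 : \forall t \near (0 : C), disc (of_real r) t.
Proof. by apply: near_disc; rewrite /disc /= normr0 of_real_gt0. Qed.

Let id0 : t @[t --> (0 : C)^'] --> (0 : C).
Proof. exact: (@cvg_within _ (nbhs (0 : C))). Qed.

Let exp0 m : (0 < m)%N -> t ^+ m @[t --> (0 : C)^'] --> (0 : C).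
Proof.
move=> m0; have z : (0 : C) ^+ m = 0 by rewrite expr0n gtn_eqF.
have H : t ^+ m @[t --> (0 : C)^'] --> (0 : C) ^+ m.
  exact: (@cvg_exprn _ _ (0 : C)^').
by rewrite z in H.
Qed.

Let near_lt (h : C -> C) (d : C) : 0 < d -> h @ (0 : C)^' --> (0 : C) ->
  \forall t \near (0 : C)^', `|h t| < d.
Proof. by move=> d0 /cvgr0Pnorm_lt; apply. Qed.

(** The secants of the second branch through the origin tend to its tangent line. *)
Lemma first_vector_in_cone (b : C) : relative_tangent_cone X Y (b *: e1).
Proof.
have [_ Phi0 _ _] := bPhi; have [_ _ fPsi _] := bPsi.
have X0 : X 0 by rewrite -Phi0; apply: XPhi; rewrite /disc /= normr0 of_real_gt0.
apply: (@cone_of_param _ _ X Y (fun=> 0) Psi (fun t => b / t ^+ l)).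
- by rewrite near_withinE; apply: filterS disc0 => t tr _; split=> //; exact: YPsi.
- exact: (@cvg_cst _ _ _ (0 : C)^').
- exact: branch_cvg bPsi id0.
apply: (@cvg_rV _ _ _ (0 : C)^') => j; have [-> |j0] := eqVneq j 0.
  apply: (@cvg_near_cst _ _ _ _ (0 : C)^'); rewrite near_withinE.
  apply: filterS disc0 => t tr t0.
  by rewrite !mxE !eqxx fPsi// subr0 mulr1 divfK// expf_neq0.
have -> : (b *: e1) 0 j = 0 by rewrite !mxE (negbTE j0) andbF mulr0.
have [M [d [M0 d0 HM]]] := branch_le r_gt0 bPsi j0.
apply: (@cvg0_le _ _ (0 : C)^' _ _ _ _ id (`|b| * M)) id0; first by rewrite mulr_ge0.
have td := near_lt d0 id0.
have tn : \forall t \near (0 : C)^', t != 0 by rewrite near_withinE; exact: nearW.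
apply: filterS2 td tn => t td t0.
have t1 : 0 < `|t| by rewrite normr_gt0.
rewrite !mxE subr0 !normrM normfV normrX -mulrA -[leRHS]mulrA ler_wpM2l//.
by rewrite ler_pdivrMl ?exprn_gt0// mulrCA -exprSr HM.
Qed.

(** Moving the parameter of the second branch from [e * t ^+ k] to
    [e * (t ^+ k * (1 + c * t ^+ m))] changes the point essentially along the first
    basis vector, and with [m = N - k * l] the change has the order [N] of the
    gap, so both contribute to the limit. *)
Lemma contact_direction_in_cone (e a b : C) (N : nat) (G : C -> 'rV[C]_n.+1)
    (v : 'rV[C]_n.+1) : e ^+ l = 1 -> a != 0 -> (k * l < N)%N ->
  (forall t, gap k l Phi Psi e t = t ^+ N *: G t) -> G t @[t --> (0 : C)] --> v ->
  relative_tangent_cone X Y (a *: v + b *: e1).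
Proof.
move=> el a0 klN gapE Gv.
have [_ _ fPsi _] := bPsi.
pose m := (N - k * l)%N.
have m0 : (0 < m)%N by rewrite subn_gt0.
have NE : N = (k * l + m)%N by rewrite subnKC// ltnW.
have l0 : l%:R != 0 :> C by rewrite pnatr_eq0 -lt0n.
(* [- a * c * l] is the limit of the first coordinate of the scaled difference. *)
have [c cE] : exists c, - (a * c) * l%:R = b.
  by exists (- b / (a * l%:R)); field; rewrite a0 l0.
pose f t : C := 1 + c * t ^+ m.
pose s t := e * (t ^+ k * f t).
have cst0 (z : C) : z @[_ --> (0 : C)^'] --> z by exact: (@cvg_cst _ _ _ (0 : C)^').
have f1 : f @ (0 : C)^' --> (1 : C).
  have H : f @ (0 : C)^' --> 1 + c * 0.
    exact: (@cvgD _ _ _ (0 : C)^' _ _ _ _ _ (cst0 1)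
      (@cvgM _ _ (0 : C)^' _ _ _ _ _ (cst0 c) (exp0 m0))).
  by rewrite mulr0 addr0 in H.
have s0 : s @ (0 : C)^' --> (0 : C).
  have H : s @ (0 : C)^' --> e * (0 * 1).
    exact: (@cvgM _ _ (0 : C)^' _ _ _ _ _ (cst0 e)
      (@cvgM _ _ (0 : C)^' _ _ _ _ _ (exp0 k_gt0) f1)).
  by rewrite mul0r mulr0 in H.
have q0 : e * t ^+ k @[t --> (0 : C)^'] --> (0 : C).
  have H : e * t ^+ k @[t --> (0 : C)^'] --> e * 0.
    exact: (@cvgM _ _ (0 : C)^' _ _ _ _ _ (cst0 e) (exp0 k_gt0)).
  by rewrite mulr0 in H.
have tn : \forall t \near (0 : C)^', t != 0 by rewrite near_withinE; exact: nearW.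
have rC : 0 < of_real r by rewrite of_real_gt0.
apply: (@cone_of_param _ _ X Y (fun t => Phi (t ^+ l)) (fun t => Psi (s t))
  (fun t => - a / t ^+ N)).
- apply: filterS2 (near_lt rC (exp0 l_gt0)) (near_lt rC s0) => t t1 t2.
  by split; [exact: XPhi|exact: YPsi].
- exact: branch_cvg bPhi (exp0 l_gt0).
- exact: branch_cvg bPsi s0.
pose B t := (- a / t ^+ N) *: (Psi (s t) - Psi (e * t ^+ k)).
apply: (@cvg_trans _ ((a *: G t + B t) @[t --> (0 : C)^'])).
  apply: near_eq_cvg; apply: filterS tn => t t0.
  have aG : a *: G t = (a / t ^+ N) *: gap k l Phi Psi e t.
    by rewrite gapE scalerA divfK// expf_neq0.
  by rewrite aG /B /gap mulNr; apply/rowP => j; rewrite !mxE; ring.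
apply: (@cvgD _ _ _ (0 : C)^').
  have Gv' : G t @[t --> (0 : C)^'] --> v by exact: cvg_within_filter Gv.
  exact: (@cvgZ _ _ _ (0 : C)^' _ _ _ _ _ (cst0 a) Gv').
apply: (@cvg_rV _ _ _ (0 : C)^') => j; have [-> |j0] := eqVneq j 0.
  have -> : (b *: e1) 0 0 = - (a * c) * l%:R.
    by rewrite !mxE !eqxx mulr1 cE.
  have H : - (a * c) * \sum_(i < l) f t ^+ i @[t --> (0 : C)^'] --> - (a * c) * l%:R.
    exact: (@cvgM _ _ (0 : C)^' _ _ _ _ _ (cst0 (- (a * c)))
      (@cvg_geometric_sum _ _ (0 : C)^' _ f l f1)).
  apply: (cvg_trans _ H); apply: near_eq_cvg.
  apply: filterS3 (near_lt rC s0) (near_lt rC q0) tn => t t1 t2 t0.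
  rewrite /B !mxE !fPsi// /s !exprMn el !mul1r -exprM -[X in _ - X]mulr1 -mulrBr.
  rewrite subrX1 /f addrAC subrr add0r NE exprD.
  have tk : t ^+ (k * l) != 0 by rewrite expf_neq0.
  have tm : t ^+ m != 0 by rewrite expf_neq0.
  by field; rewrite tk tm.
have -> : (b *: e1) 0 j = 0 by rewrite !mxE (negbTE j0) andbF mulr0.
have [M [d [M0 d0 HM]]] := branch_lipschitz r_gt0 bPsi j0.
have e_1 : `|e| = 1 by exact: norm_unity_root el.
apply: (@cvg0_le _ _ (0 : C)^' _ _ _ _ (fun t => t ^+ k)
  (`|a| * M * (2 + `|c|) ^+ l * `|c|)) (exp0 k_gt0).
  by rewrite !mulr_ge0 ?exprn_ge0 ?addr_ge0.
have near1 := near_lt ltr01 id0.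
apply: filterS2 (filterI (near_lt d0 s0) (near_lt d0 q0)) (filterI near1 tn).
move=> t [sd qd] [t1 t0].
have tN : 0 < `|t| ^+ N by rewrite exprn_gt0// normr_gt0.
have tk0 : 0 <= `|t| ^+ k by rewrite exprn_ge0.
have sq : `|s t - e * t ^+ k| = `|c| * `|t| ^+ (k + m).
  rewrite /s /f -mulrBr normrM e_1 mul1r mulrDr mulr1 addrAC subrr add0r mulrCA.
  by rewrite -exprD normrM normrX.
have sle : `|s t| + `|e * t ^+ k| <= (2 + `|c|) * `|t| ^+ k.
  rewrite /s !normrM e_1 !mul1r !normrX -[X in _ + X <= _]mulr1 -mulrDr [leRHS]mulrC ler_wpM2l//.
  rewrite (_ : 2 + `|c| = (1 + `|c|) + 1); last by ring.
  rewrite lerD2r (le_trans (ler_normD _ _))// normr1 lerD2l normrM normrX.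
  by rewrite ler_piMr// exprn_ile1// ltW.
have -> : `|B t 0 j| = `|a| / `|t| ^+ N * `|Psi (s t) 0 j - Psi (e * t ^+ k) 0 j|.
  by rewrite /B !mxE !normrM normrN normfV normrX.
rewrite mulrAC ler_pdivrMr//.
have sle' : (`|s t| + `|e * t ^+ k|) ^+ l <= ((2 + `|c|) * `|t| ^+ k) ^+ l.
  by rewrite lerXn2r ?nnegrE ?addr_ge0 ?mulr_ge0 ?addr_ge0.
apply: le_trans (ler_wpM2l _ (HM _ _ sd qd)) _ => //; rewrite sq.
apply: (@le_trans _ _ (`|a| * (M * ((2 + `|c|) * `|t| ^+ k) ^+ l *
  (`|c| * `|t| ^+ (k + m))))).
  by rewrite ler_wpM2l// ler_wpM2r ?mulr_ge0 ?exprn_ge0// ler_wpM2l.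
rewrite exprMn -exprM NE !exprD normrX.
by rewrite le_eqVlt; apply/orP; left; apply/eqP; ring.
Qed.

Lemma Lin_in_cone e : e ^+ l = 1 ->
  Lin (contact_direction R k l (of_real r) Phi Psi e) e1 `<=` relative_tangent_cone X Y.
Proof.
move=> el u /LinP[a [b ->]].
have [->|a0] := eqVneq a 0; first by rewrite scale0r add0r; exact: first_vector_in_cone.
have [[-> _]|[N [G [v0 klN gapE Gv]]]] :=
  contact_direction_spec r_gt0 l_gt0 k_gt0 bPhi bPsi el.
  by rewrite scaler0 add0r; exact: first_vector_in_cone.
exact: contact_direction_in_cone el a0 klN gapE Gv.
Qed.

End SpansInCone.
End TwoBranches.

(** * From the cone to the spans *)

Section ConeInLin.
Context {R : realType} {n : nat}.
Notation C := (CC R).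
Notation e1 := (delta_mx 0 0 : 'rV[C]_n.+1).
Variables (k l : nat) (r : R) (Phi Psi : C -> 'rV[C]_n.+1).
Hypotheses (r_gt0 : 0 < r) (l_gt0 : (0 < l)%N) (k_gt0 : (0 < k)%N).
Hypotheses (bPhi : branch k r Phi) (bPsi : branch l r Psi).

(** Along a filter on which the root of unity [e] nearest to the second parameter
    is fixed, the scaled difference of the two points is a vector tending to
    a multiple of the first basis vector, minus the scaled gap, whose limit is
    proportional to the contact direction. *)
Lemma limit_in_Lin (T : Type) (F : set_system T) {FF : ProperFilter F}
    (t tau la : T -> C) (e : C) (u : 'rV[C]_n.+1) :
  e ^+ l = 1 -> t @ F --> (0 : C) -> tau @ F --> (0 : C) ->
  (\forall j \near F, forall x, x ^+ l = 1 ->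
     `|tau j - e * t j ^+ k| <= `|tau j - x * (e * t j ^+ k)|) ->
  la j *: (Psi (tau j) - Phi (t j ^+ l)) @[j --> F] --> u ->
  Lin (contact_direction R k l (of_real r) Phi Psi e) e1 u.
Proof.
move=> el t0 tau0 nearest lau.
have [_ _ fPhi _] := bPhi; have [_ _ fPsi _] := bPsi.
have rC : 0 < of_real r by rewrite of_real_gt0.
pose b j := e * t j ^+ k.
have X0 m (f : T -> C) : (0 < m)%N -> f @ F --> (0 : C) -> f j ^+ m @[j --> F] --> (0 : C).
  move=> m0 f0; have z : (0 : C) ^+ m = 0 by rewrite expr0n gtn_eqF.
  by rewrite -[X in _ --> X]z; exact: cvg_exprn.
have b0 : b @ F --> (0 : C).
  rewrite -[X in _ --> X](mulr0 e); apply: cvgM; first exact: cvg_cst.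
  exact: X0.
have near_lt (f : T -> C) (d : C) : 0 < d -> f @ F --> (0 : C) -> \forall j \near F, `|f j| < d.
  by move=> d0 /cvgr0Pnorm_lt; apply.
pose B j := la j *: (Psi (tau j) - Psi (b j)).
pose beta j := tau j ^+ l - b j ^+ l.
have diffE j : la j *: (Psi (tau j) - Phi (t j ^+ l)) =
    B j - la j *: gap k l Phi Psi e (t j).
  by rewrite /B /gap -scalerBr; congr (_ *: _); rewrite opprB addrA subrK.
have betau : la j * beta j @[j --> F] --> u 0 0.
  have lau0 : (la j *: (Psi (tau j) - Phi (t j ^+ l))) 0 0 @[j --> F] --> u 0 0.
    exact: cvg_rV_coord.
  apply: (cvg_trans _ lau0); apply: near_eq_cvg.
  apply: filterS2 (near_lt _ _ rC tau0) (near_lt _ _ rC (X0 _ _ l_gt0 t0)) => j tj sj.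
  by rewrite !mxE fPsi// fPhi// /beta /b exprMn el mul1r -!exprM mulnC.
have [c c0 Hc] := @nearest_root_lower_bound C l l_gt0.
have Bu : B @ F --> u 0 0 *: e1.
  apply: cvg_rV => i; have [-> |i0] := eqVneq i 0.
    rewrite !mxE !eqxx mulr1; apply: (cvg_trans _ betau); apply: near_eq_cvg.
    apply: filterS2 (near_lt _ _ rC tau0) (near_lt _ _ rC b0) => j tj bj.
    by rewrite !mxE !fPsi.
  have -> : (u 0 0 *: e1) 0 i = 0 by rewrite !mxE (negbTE i0) andbF mulr0.
  have [M [d [M0 d0 HM]]] := branch_lipschitz r_gt0 bPsi i0.
  have mu_0 : `|tau j| + `|b j| @[j --> F] --> (0 : C).
    have H : `|tau j| + `|b j| @[j --> F] --> `|0 : C| + `|0 : C|.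
      exact: cvgD (cvg_norm tau0) (cvg_norm b0).
    by rewrite normr0 addr0 in H.
  have g0 : (la j * beta j) * (`|tau j| + `|b j|) @[j --> F] --> (0 : C).
    have H := cvgM betau mu_0; rewrite mulr0 in H; exact: H.
  apply: (cvg0_le (A := M / c)) g0; first by rewrite divr_ge0// ltW.
  apply: filterS3 (near_lt _ _ d0 tau0) (near_lt _ _ d0 b0) nearest => j tj bj Hj.
  have low := Hc _ _ Hj; rewrite -/(b j) -/(beta j) in low.
  have muE : `| (`|tau j| + `|b j|) | = `|tau j| + `|b j| by rewrite ger0_norm// addr_ge0.
  have mu0 : 0 <= `|tau j| + `|b j| by rewrite addr_ge0.
  rewrite [`|B j 0 i|](_ : _ = `|la j| * `|Psi (tau j) 0 i - Psi (b j) 0 i|); last first.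
    by rewrite /B !mxE normrM.
  rewrite [`|la j * beta j * _|]normrM [`|la j * beta j|]normrM muE.
  apply: le_trans (ler_wpM2l _ (HM _ _ tj bj)) _ => //.
  move: (`|tau j| + `|b j|) mu0 low => mu mu0 low.
  rewrite (_ : _ / _ * _ = `|la j| * (M * mu * (c^-1 * `|beta j|))); last by ring.
  rewrite ler_wpM2l// -(prednK l_gt0) exprS !mulrA -!mulrA ler_wpM2l// ler_wpM2l//.
  by rewrite ler_pdivlMl// mulrA.
pose w := u 0 0 *: e1 - u.
have gapu : la j *: gap k l Phi Psi e (t j) @[j --> F] --> w.
  have H : B j - la j *: (Psi (tau j) - Phi (t j ^+ l)) @[j --> F] --> u 0 0 *: e1 - u.
    exact: cvgB Bu lau.
  apply: (cvg_trans _ H); apply: near_eq_cvg; apply: nearW => j.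
  by rewrite /= diffE opprB addrC subrK.
apply/LinP.
have [[_ gapz]|[N [G [v0 _ gapE Gv]]]] :=
  contact_direction_spec r_gt0 l_gt0 k_gt0 bPhi bPsi el.
  exists 0, (u 0 0); rewrite scale0r add0r; apply/eqP; rewrite eq_sym -subr_eq0; apply/eqP.
  apply: (cvg_unique _ gapu); first exact: norm_hausdorff.
  apply: cvg_near_cst; have := t0 _ gapz; rewrite nbhs_filterE /=.
  by apply: filterS => j /= ->; rewrite scaler0.
set v := contact_direction _ _ _ _ _ _ _ in v0 Gv *.
have Gt : G (t j) @[j --> F] --> v by exact: cvg_comp t0 Gv.
have [q vq] : exists q, v 0 q != 0.
  apply: contrapT => nq; move/eqP: v0; apply; apply/rowP => q; rewrite mxE.
  by apply: contrapT => /eqP vq; apply: nq; exists q.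
have lat : la j * t j ^+ N @[j --> F] --> w 0 q / v 0 q.
  have Gq : G (t j) 0 q @[j --> F] --> v 0 q by exact: cvg_rV_coord.
  have gapq : (la j *: gap k l Phi Psi e (t j)) 0 q @[j --> F] --> w 0 q.
    exact: (@cvg_rV_coord _ _ _ F (fun j => la j *: gap k l Phi Psi e (t j)) w q gapu).
  have H : (la j *: gap k l Phi Psi e (t j)) 0 q * (G (t j) 0 q)^-1 @[j --> F] -->
      w 0 q / v 0 q.
    exact: cvgM gapq (cvgV vq Gq).
  apply: (cvg_trans _ H); apply: near_eq_cvg.
  have : \forall j \near F, G (t j) 0 q != 0.
    have vq0 : 0 < `|v 0 q| by rewrite normr_gt0.
    have /cvgrPdist_lt/(_ _ vq0) := Gq; apply: filterS => j.
    by apply: contraTneq => ->; rewrite subr0 ltxx.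
  by apply: filterS => j Gj; rewrite gapE !mxE mulrA mulfK.
have wE : w = (w 0 q / v 0 q) *: v.
  apply: (cvg_unique _ gapu); first exact: norm_hausdorff.
  have H : (la j * t j ^+ N) *: G (t j) @[j --> F] --> (w 0 q / v 0 q) *: v.
    exact: cvgZ lat Gt.
  apply: (cvg_trans _ H); apply: near_eq_cvg; apply: nearW => j.
  by rewrite gapE scalerA.
exists (- (w 0 q / v 0 q)), (u 0 0); rewrite scaleNr -wE /w opprB.
by rewrite subrK.
Qed.

(** Write the points as [Phi (t ^+ l)] and [Psi tau]. A root of unity [eps i] with
    [eps i * t ^+ k] nearest to [tau] depends on the index of the sequences, but one
    of the finitely many [i] occurs infinitely often. *)
Lemma cone_in_Lin (X Y : set 'rV[C]_n.+1) (eps : 'I_l -> C) :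
  (\forall x \near (0 : 'rV[C]_n.+1), X x -> exists2 t, disc (of_real r) t & Phi t = x) ->
  (\forall x \near (0 : 'rV[C]_n.+1), Y x -> exists2 t, disc (of_real r) t & Psi t = x) ->
  (forall z, z ^+ l = 1 <-> exists i, eps i = z) ->
  relative_tangent_cone X Y `<=`
  \bigcup_(i in [set: 'I_l])
     Lin (contact_direction R k l (of_real r) Phi Psi (eps i)) e1.
Proof.
move=> XPhi YPsi epsP u [x [y [la [[Xx Yy] x0 y0 lau]]]].
have [_ _ fPhi _] := bPhi; have [_ _ fPsi _] := bPsi.
have param (m : nat) (Th : C -> 'rV[C]_n.+1) (Z : set 'rV[C]_n.+1) (z : nat -> 'rV[C]_n.+1) :
    (0 < m)%N -> (forall t, disc (of_real r) t -> Th t 0 0 = t ^+ m) ->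
    (\forall x \near (0 : 'rV[C]_n.+1), Z x -> exists2 t, disc (of_real r) t & Th t = x) ->
    (forall j, Z (z j)) -> z @ \oo --> (0 : 'rV[C]_n.+1) ->
    exists2 s : nat -> C, s @ \oo --> (0 : C) & \forall j \near \oo, Th (s j) = z j.
  move=> m0 fTh ZTh Zz z0.
  have /choice[s Hs] (j : nat) : exists s, (exists2 t, disc (of_real r) t & Th t = z j) ->
      disc (of_real r) s /\ Th s = z j.
    by have [[t tr tz]|nt] := pselect (exists2 t, disc (of_real r) t & Th t = z j);
      [exists t|exists 0].
  have near_s : \forall j \near \oo, disc (of_real r) (s j) /\ Th (s j) = z j.
    have := z0 _ ZTh; rewrite nbhs_filterE /=.
    by apply: filterS => j /= Hj; apply/Hs/Hj.
  exists s; last by apply: filterS near_s => j [].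
  apply: (cvg0_expr m0).
  have H : z j 0 0 @[j --> \oo] --> (0 : 'rV[C]_n.+1) 0 0 by exact: cvg_rV_coord.
  rewrite mxE in H; apply: (cvg_trans _ H); apply: near_eq_cvg; apply: filterS near_s => j [sr <-].
  by rewrite fTh.
have [s s0 sx] := param k Phi X x k_gt0 fPhi XPhi Xx x0.
have [tau tau0 tauy] := param l Psi Y y l_gt0 fPsi YPsi Yy y0.
pose t j := l.-root (s j).
have tE j : t j ^+ l = s j by rewrite rootCK.
have t0 : t @ \oo --> (0 : C).
  by apply: (cvg0_expr l_gt0); under eq_fun do rewrite tE.
pose i0 := Ordinal l_gt0.
have /choice[idx Hidx] (j : nat) : exists i, forall i',
    `|tau j - eps i * t j ^+ k| <= `|tau j - eps i' * t j ^+ k|.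
  exists [arg min_(i < i0) re `|tau j - eps i * t j ^+ k| ]%O.
  case: arg_minP => // i _ Hi i'; rewrite -of_real_norm -[leRHS]of_real_norm.
  by rewrite le_of_real Hi.
have [i Pi] : exists i, ~ \forall j \near \oo, idx j <> i.
  apply: contrapT => nP.
  have : \forall j \near \oo, forall i, idx j <> i.
    apply: filter_forall => i; apply: contrapT => ni; apply: nP; by exists i.
  by move=> [N _ /(_ N (leqnn N))]; apply.
exists i => //.
pose F := within (fun j => idx j = i) \oo.
have FF : ProperFilter F.
  split; last exact: within_filter.
  by move=> F0; apply: Pi; apply: filterS F0 => j.
have FO (P : set nat) : \oo P -> F P.
  by rewrite /F /within /= => HP; apply: filterS HP => j.
have cF (V : topologicalType) (f : nat -> V) (a : V) : f @ \oo --> a -> f @ F --> a.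
  by move=> fa A /fa; exact: FO.
have ei : eps i ^+ l = 1 by apply/epsP; exists i.
apply: (@limit_in_Lin nat F FF t tau la (eps i) u ei (cF _ _ _ t0) (cF _ _ _ tau0)).
  rewrite /F near_withinE; apply: nearW => j <- z zl; rewrite mulrA.
  have /epsP[i' <-] : (z * eps (idx j)) ^+ l = 1.
    by rewrite exprMn zl mul1r; apply/epsP; exists (idx j).
  exact: Hidx.
have H := cF _ _ _ lau; apply: (cvg_trans _ H); apply: near_eq_cvg; apply: FO.
by apply: filterS2 sx tauy => j <- <-; rewrite tE.
Qed.

End ConeInLin.

Theorem theorem3p4 (R : realType) (n : nat)
    (U X Y : set 'rV[CC R]_n.+1)
    (U0 : U 0)
    (curveX : analytic_curve U X) (curveY : analytic_curve U Y)
    (X0 : X 0) (Y0 : Y 0)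
    (irrX : irreducible_germ 0 X) (irrY : irreducible_germ 0 Y)
    (r : R) (r_gt0 : 0 < r)
    (k l : nat)
    (Phi Psi : CC R -> 'rV[CC R]_n.+1)
    (paramX : parametrization U X 0 (of_real r) Phi)
    (Phi_first : forall t : CC R, disc (of_real r) t -> Phi t 0 0 = t ^+ k)
    (Phi_rest : forall i : 'I_n.+1, i != 0 ->
       (k%:R%:E < ord R (fun t : CC R => Phi t 0%R i))%E)
    (paramY : parametrization U Y 0 (of_real r) Psi)
    (Psi_first : forall t : CC R, disc (of_real r) t -> Psi t 0 0 = t ^+ l)
    (Psi_rest : forall i : 'I_n.+1, i != 0 ->
       (l%:R%:E < ord R (fun t : CC R => Psi t 0%R i))%E)
    (l_le_k : (l <= k)%N)
    (eps : 'I_l -> CC R)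
    (eps_roots : forall z : CC R, z ^+ l = 1 <-> exists i, eps i = z) :
  relative_tangent_cone X Y =
  \bigcup_(i in [set: 'I_l])
    Lin (contact_direction R k l (of_real r) Phi Psi (eps i)) (delta_mx 0 0).
Proof.
have l_gt0 : (0 < l)%N.
  by have [+ _] := eps_roots 1; rewrite expr1n => /(_ erefl)[i _]; exact: leq_ltn_trans (ltn_ord i).
have k_gt0 : (0 < k)%N by exact: leq_trans l_le_k.
have [hPhi _ Phi0 _ [UX [oUX _ UX0 PhiX]]] := paramX.
have [hPsi _ Psi0 _ [UY [oUY _ UY0 PsiY]]] := paramY.
have bPhi : branch k r Phi by [].
have bPsi : branch l r Psi by [].
apply/seteqP; split.
  apply: cone_in_Lin => //.
    have : \forall x \near (0 : 'rV[CC R]_n.+1), UX x by exact: open_nbhs_nbhs.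
    apply: filterS => x Ux Xx; have : (X `&` UX) x by [].
    by rewrite -PhiX => -[t tr <-]; exists t.
  have : \forall x \near (0 : 'rV[CC R]_n.+1), UY x by exact: open_nbhs_nbhs.
  apply: filterS => x Ux Yx; have : (Y `&` UY) x by [].
  by rewrite -PsiY => -[t tr <-]; exists t.
move=> u [i _]; apply: (Lin_in_cone r_gt0 l_gt0 k_gt0 bPhi bPsi).
- by move=> t tr; have [] : (X `&` UX) (Phi t) by rewrite -PhiX; exists t.
- by move=> t tr; have [] : (Y `&` UY) (Psi t) by rewrite -PsiY; exists t.
- by apply/eps_roots; exists i.
Qed.
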